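(* Assume $V$ is positive definite, that $i_n$, $n\ge0$, are i.i.d. uniformly distributed on $\{1,\dots,d\}$, and let $h$ be a $(\kappa,\gamma,V)$-Lipschitz function on $\mathbb R^d$ with $m=E(h(X))$, $X\sim N(0,V)$. Then, as $n\to\infty$, $$n\,E\Big(\Big(\frac{\sum_{j=0}^{n-1}h(X_j)}{n}-m\Big)^2\Big)\longrightarrow c,$$ where $c=\mathrm{Var}(h(\sqrt V Z_0))+2\sum_{j=1}^\infty\mathrm{Cov}(h(\sqrt V Z_0),h(\sqrt V Z_j))$.
   Context: Let $d\ge1$ and let $V$ be a real symmetric positive semi-definite $d\times d$ matrix whose diagonal entries all equal $1$. Write $\sqrt V$ for its symmetric positive semi-definite square root and $I$ for the $d\times d$ identity matrix. Let $e_i$ be the $i$-th standard basis column vector of $\mathbb R^d$. Let $(i_n)_{n\ge0}$ be a sequence of indices in $\{1,\dots,d\}$. Let $(g_n)_{n\ge0}$ be i.i.d. standard Gaussian random variables, and let $Z_0$ be a $d$-dimensional vector of i.i.d. standard Gaussian random variables, with $(i_n)$, $(g_n)$ and $Z_0$ mutually independent. Define $X_0=0$ and $X_{n+1}=X_n+(g_n-e_{i_n}^TX_n)\,Ve_{i_n}$ for $n\ge0$. For $1\le i\le d$ let $f_i=\sqrt V e_i$ and $P_i=I-f_if_i^T$. Define $Y_0=0$ and $Y_{n+1}=P_{i_n}Y_n+g_nf_{i_n}$. Let $M_n=P_{i_{n-1}}\cdots P_{i_0}$ with $M_0=I$, and $Z_n=Y_n+M_nZ_0$ for $n\ge1$.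 For a vector $x$, $\|x\|$ is its Euclidean norm; for a centered random vector $Z$, $\mathrm{cov}(Z)=E(ZZ^T)$; $A\le B$ means $B-A$ is positive semi-definite. Given $\kappa>0$, $\gamma\in(0,1]$ and a $d\times d$ positive semi-definite matrix $W$, a real-valued Borel function $h$ on $\mathbb R^d$ is $(\kappa,\gamma,W)$-Lipschitz if $E((h(X)-h(X'))^2)\le\kappa^2(E\|X-X'\|^2)^{\gamma}$ for every centered Gaussian vector $(X,X')$ in $\mathbb R^{2d}$ ($X,X'$ each $d$-dimensional) with $\mathrm{cov}(X)\le W$ and $\mathrm{cov}(X')\le W$. *)

(* Defs.v *)
From HB Require Import structures.
From mathcomp Require Import all_boot all_order all_algebra.
From mathcomp Require Import all_classical all_reals all_analysis.
Set Implicit Arguments. Unset Strict Implicit. Unset Printing Implicit Defensive.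
Import Order.TTheory GRing.Theory Num.Theory.
Import numFieldNormedType.Exports.
Local Open Scope classical_set_scope.
Local Open Scope ring_scope.

Section defs.
Context {R : realType}.

Definition Ex {dT : measure_display} {T : measurableType dT}
  (Q : probability T R) (f : T -> R) : R := fine (\int[Q]_w (f w)%:E)%E.

Definition qf {n : nat} (A : 'M[R]_n) (v : 'cV[R]_n) : R := (v^T *m A *m v) 0 0.
Definition psd {n : nat} (A : 'M[R]_n) := A^T = A /\ forall v, 0 <= qf A v.
Definition pd {n : nat} (A : 'M[R]_n) := A^T = A /\ forall v, v != 0 -> 0 < qf A v.
Definition loewner_le {n : nat} (A B : 'M[R]_n) := forall v, 0 <= qf (B - A) v.

Definition sqnorm {n : nat} (v : 'cV[R]_n) : R := \sum_(i < n) (v i 0) ^+ 2.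

Definition borel_cV (n : nat) : set (set 'cV[R]_n) :=
  <<s \bigcup_(i in [set: 'I_n]) [set (fun v : 'cV[R]_n => v i 0) @^-1` B
                                  | B in [set B : set R | measurable B]] >>.

Definition borel_fun {n : nat} (h : 'cV[R]_n -> R) :=
  forall B : set R, measurable B -> borel_cV (h @^-1` B).

Definition centered_normal_rv {dT : measure_display} {T : measurableType dT}
  (Q : probability T R) (Y : T -> R) :=
  measurable_fun setT Y /\
  (Q [set w | Y w <> 0] = 0%E \/
   exists s : R, 0 < s /\ forall B, measurable B -> Q (Y @^-1` B) = normal_prob 0 s B).

Definition centered_gaussian_vec {dT : measure_display} {T : measurableType dT}
  (Q : probability T R) {n : nat} (W : T -> 'cV[R]_n) :=
  forall u : 'cV[R]_n, centered_normal_rv Q (fun w => (u^T *m W w) 0 0).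

(** covariance matrix E(X X^T) of a centered random vector *)
Definition covm {dT : measure_display} {T : measurableType dT}
  (Q : probability T R) {n : nat} (X : T -> 'cV[R]_n) : 'M[R]_n :=
  \matrix_(i, j) Ex Q (fun w => X w i 0 * X w j 0).

Definition kgW_lipschitz {n : nat} (kappa gamma : R) (W : 'M[R]_n)
  (h : 'cV[R]_n -> R) : Prop :=
  borel_fun h /\
  forall (dT : measure_display) (T : measurableType dT) (Q : probability T R)
         (X X' : T -> 'cV[R]_n),
    centered_gaussian_vec Q (fun w => col_mx (X w) (X' w)) ->
    loewner_le (covm Q X) W -> loewner_le (covm Q X') W ->
    (\int[Q]_w (((h (X w) - h (X' w)) ^+ 2)%:E)
       <= ((kappa ^+ 2) * (Ex Q (fun w => sqnorm (X w - X' w))) `^ gamma)%:E)%E.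

Definition mutually_independent {dT : measure_display} {T : measurableType dT}
  (Q : probability T R) {I : eqType} (E : I -> set (set T)) :=
  forall (F : seq I), uniq F -> forall A : I -> set T,
    (forall j, j \in F -> E j (A j)) ->
    Q (\bigcap_(j in [set` F]) A j) = (\prod_(j <- F) Q (A j))%E.

Section processes.
Context {dT : measure_display} {T : measurableType dT} {d : nat}.
Variables (V S : 'M[R]_d) (ind : nat -> T -> 'I_d) (g : nat -> T -> R)
          (Z0 : T -> 'cV[R]_d).

Fixpoint Xproc (n : nat) (w : T) : 'cV[R]_d :=
  match n with
  | 0 => 0
  | n'.+1 => let x := Xproc n' w in
             x + (g n' w - x (ind n' w) 0) *: col (ind n' w) V
  end.

Definition fvec (k : 'I_d) : 'cV[R]_d := col k S.
Definition Pmat (k : 'I_d) : 'M[R]_d := 1%:M - fvec k *m (fvec k)^T.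

Fixpoint Yproc (n : nat) (w : T) : 'cV[R]_d :=
  match n with
  | 0 => 0
  | n'.+1 => Pmat (ind n' w) *m Yproc n' w + g n' w *: fvec (ind n' w)
  end.

Fixpoint Mproc (n : nat) (w : T) : 'M[R]_d :=
  match n with
  | 0 => 1%:M
  | n'.+1 => Pmat (ind n' w) *m Mproc n' w
  end.

Definition Zproc (n : nat) (w : T) : 'cV[R]_d := Yproc n w + Mproc n w *m Z0 w.

Definition indep_events (j : (nat + (nat + 'I_d))%type) : set (set T) :=
  match j with
  | inl n => [set ind n @^-1` K | K in [set: set 'I_d]]
  | inr (inl n) => [set g n @^-1` B | B in [set B : set R | measurable B]]
  | inr (inr k) => [set (fun w => Z0 w k 0) @^-1` B
                    | B in [set B : set R | measurable B]]
  end.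
End processes.

End defs.

(* Main.v *)
(** Write [X_n = S Y_n] and compare [Y_n] with the stationary chain [Z_n].  Conditionally on
    the indices, [(Y_n, Z_n)] is a linear image of the standard Gaussian vector
    [(Z_0, g_0, ..., g_(n-1))], so the Lipschitz hypothesis applies and bounds
    [E (h(S Z_n) - h(S Y_n))^2] by a multiple of [(E |S M_n Z_0|^2)^gamma].  Since the [f_k f_k^T]
    sum to [V], applying [P_k] with [k] uniform shrinks [|x|^2] in mean by a factor
    [1 - lambda / d], with [V >= lambda > 0]; hence this bound decays geometrically.

    The map taking the input to [(Z_i, g_i, ..., g_(i+j-1))] is a coisometry, and coisometries
    preserve standard Gaussian vectors (by plane rotations), so [h(S Z_n)] is stationary.
    As [Y_j] is independent of [Z_0], the covariance at lag [j] only involves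
    [h(S Z_j) - h(S Y_j)] and decays geometrically.  Cesaro's lemma then gives the limit for
    the stationary chain, and the two partial sums differ by a bounded amount in [L^2]. *)

Require Import Defs.
From HB Require Import structures.
From mathcomp Require Import all_boot all_order all_algebra.
From mathcomp Require Import all_classical all_reals all_analysis.
From mathcomp Require Import measurable_realfun ring lra.
Import Order.TTheory GRing.Theory Num.Theory.
Import numFieldNormedType.Exports.
Local Open Scope classical_set_scope.
Local Open Scope ring_scope.

Set Implicit Arguments. Unset Strict Implicit. Unset Printing Implicit Defensive.

(** Unconditionally [(Y_n, Z_n)] is a mixture of Gaussian vectors, to which the Lipschitz hypothesis
    does not apply directly; hence every estimate is made for a frozen index sequence and then
    averaged over the [d^n] equally likely ones. The distance between the two chains depends on the
    sequence, so its power [gamma] has to be averaged as well, which an affine majorant permits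
    because [gamma <= 1]. The unit diagonal of [V] makes each [f_k] a unit vector and [P_k] the
    orthogonal projection off it, so [P_k P_k^T + f_k f_k^T = I]: the step from [(Z, g)] to
    [P_k Z + g f_k] is a coisometry. Gaussian vectors are described by the masses of boxes, which
    determine the law; invariance under coisometries then reduces to sign changes and plane
    rotations. Definiteness of [V] enters through the invertibility of [S]. *)

Definition pushm (R : realType) d1 d2 (T1 : measurableType d1) (T2 : measurableType d2)
  (f : T1 -> T2) (mf : measurable_fun setT f) (mu : {measure set T1 -> \bar R}) :
  {measure set T2 -> \bar R} :=
  measure_function_pushforward__canonical__measure_function_Measure mu mf.

Lemma ge0_integral_pushm (R : realType) d1 d2 (T1 : measurableType d1) (T2 : measurableType d2)
  (f : T1 -> T2) (mf : measurable_fun setT f) (mu : {measure set T1 -> \bar R})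
  (F : T2 -> \bar R) : measurable_fun setT F -> (forall y, 0 <= F y)%E ->
  (\int[pushm mf mu]_y F y = \int[mu]_x F (f x))%E.
Proof. by move=> mF F0; rewrite ge0_integral_pushforward// preimage_setT. Qed.

(** * The standard normal distribution *)

Section NormalProb.
Context {R : realType}.
Local Notation mu := (@lebesgue_measure R).
Local Notation gam := (@normal_prob R 0 1).
Local Notation phi := (@normal_pdf R 0 1).

Import HBNNSimple.

(** [normal_prob] integrates its density over a set; simple functions and monotone convergence carry
    the formula to nonnegative functions. *)
Lemma integral_normal_probE (m s : R) (f : measurableTypeR R -> \bar R) :
  measurable_fun setT f -> (forall x, 0 <= f x)%E ->
  (\int[normal_prob m s]_x f x = \int[mu]_x (f x * (normal_pdf m s x)%:E))%E.
Proof.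
move=> mf f0; pose f_ := nnsfun_approx measurableT mf.
have mp : measurable_fun setT (fun x : R => (normal_pdf m s x)%:E).
  by apply/measurable_EFinP; exact: measurable_normal_pdf.
have p0 x : (0 <= (normal_pdf m s x)%:E)%E by rewrite lee_fin normal_pdf_ge0.
have nn (h : {nnsfun (measurableTypeR R) >-> R}) :
  (\int[normal_prob m s]_x (h x)%:E = \int[mu]_x ((h x)%:E * (normal_pdf m s x)%:E))%E.
  under [LHS]eq_integral do rewrite fimfunE -fsumEFin//.
  rewrite [LHS]ge0_integral_fsum//; last 2 first.
  - by move=> r; exact/measurable_EFinP/measurableT_comp.
  - by move=> n x _; rewrite EFinM nnfun_muleindic_ge0.
  under [RHS]eq_integral.
    move=> x xD; rewrite fimfunE -fsumEFin// ge0_mule_fsuml; last first.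
      by move=> r; rewrite EFinM nnfun_muleindic_ge0.
    over.
  rewrite [RHS]ge0_integral_fsum//; last 2 first.
  - move=> r; apply: emeasurable_funM => //.
    by apply/measurable_EFinP/measurable_funM => //.
  - by move=> n x _; rewrite mule_ge0// EFinM nnfun_muleindic_ge0.
  apply: eq_fsbigr => r _.
  have [r0|r0] := ltP r 0.
    rewrite !integral0_eq// => x _; rewrite preimage_nnfun0// indicE in_set0 mulr0//.
    by rewrite mul0e.
  under [LHS]eq_integral do rewrite EFinM.
  rewrite ge0_integralZl//; last 1 first.
    by apply/measurable_EFinP.
  rewrite integral_indic// setIT /normal_prob.
  under [RHS]eq_integral do rewrite EFinM -muleA.
  rewrite [RHS]ge0_integralZl//; last 2 first.
  - apply: emeasurable_funM => //.
    by apply/measurable_EFinP.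
  - by move=> x _; rewrite mule_ge0// lee_fin.
  congr (_ * _)%E; rewrite [LHS]/= /normal_prob [LHS]integral_mkcond.
  apply: eq_integral => x _.
  by rewrite patchE indicE; case: ifPn => _; rewrite ?mul1e ?mul0e.
transitivity (limn (fun n => \int[normal_prob m s]_x (f_ n x)%:E)%E).
  rewrite -monotone_convergence//=.
  - apply: eq_integral => x /[!inE] xD; apply/esym/cvg_lim => //=.
    exact: cvg_nnsfun_approx.
  - by move=> n; exact/measurable_EFinP.
  - by move=> n x _; rewrite lee_fin.
  - by move=> x _ a b ab; rewrite lee_fin//; exact/lefP/nd_nnsfun_approx.
under eq_fun do rewrite nn.
rewrite -monotone_convergence//=.
- apply: eq_integral => x _; apply/cvg_lim => //=.
  (* Where [f x] is infinite, the product of the limits is determinate only if the density does not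
     vanish. *)
  have [->|p1] := eqVneq (normal_pdf m s x) 0.
    by under eq_fun do rewrite mule0; rewrite mule0; exact: cvg_cst.
  apply: cvgeM => //=; last 2 first.
  + by apply: cvg_nnsfun_approx.
  + exact: cvg_cst.
  have [fx|fx] := boolP (f x \is a fin_num); first exact: mule_def_fin.
  exact: mule_def_infty_neq0.
- by move=> n; apply: emeasurable_funM => //; exact/measurable_EFinP.
- by move=> n x _; rewrite mule_ge0// lee_fin.
- by move=> x _ a b ab; rewrite lee_wpmul2r// lee_fin; exact/lefP/nd_nnsfun_approx.
Qed.

(** Lebesgue measure is characterised by the lengths of half-open intervals, and the rescaled image
    measure gives them the same length. *)
Lemma ge0_integral_affine (a b : R) (f : measurableTypeR R -> \bar R) : a != 0 ->
  measurable_fun setT f -> (forall x, 0 <= f x)%E ->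
  (\int[mu]_x f x = `|a|%:E * \int[mu]_x f (a * x + b)%R)%E.
Proof.
move=> a0 mf f0.
have mg : measurable_fun setT (fun x : measurableTypeR R => a * x + b : measurableTypeR R).
  by apply: measurable_funD => //; apply: measurable_funM.
pose k : {nonneg R} := NngNum (normr_ge0 a).
have E A : measurable A -> mu A = mscale k (pushm mg mu) A.
  apply: lebesgue_measure_unique => _ [[p q] _ <-] /=.
  rewrite /mscale/= /pushforward /=.
  have [pq|qp] := leP q p.
    rewrite !lebesgue_measure_itv/= lte_fin ltNge pq/=.
    rewrite (_ : _ @^-1` _ = set0) ?measure0 ?mule0//.
    rewrite -subset0 => x /=; rewrite in_itv/= => /andP[h1 h2].
    by have := lt_le_trans h1 h2; rewrite ltNge pq.
  move: a0; rewrite neq_lt => /orP[an|ap].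
  (* A negative slope turns []p, q]] into an interval closed on the left, with the same length
     formula. *)
  - rewrite (_ : _ @^-1` _ = `[(q - b) / a, (p - b) / a[%classic); last first.
      apply/seteqP; split => x /=; rewrite !in_itv/= => /andP[h1 h2]; apply/andP; split.
      + by rewrite ler_ndivrMr//; lra.
      + by rewrite ltr_ndivlMr//; lra.
      + by move: h2; rewrite ltr_ndivlMr//; lra.
      + by move: h1; rewrite ler_ndivrMr//; lra.
    rewrite !lebesgue_measure_itv/= !lte_fin qp.
    rewrite ltr_nM2r ?invr_lt0// ltrD2r qp -!EFinD -EFinM ltr0_norm//.
    by congr EFin; field; rewrite lt_eqF.
  - rewrite (_ : _ @^-1` _ = `](p - b) / a, (q - b) / a]%classic); last first.
      apply/seteqP; split => x /=; rewrite !in_itv/= => /andP[h1 h2]; apply/andP; split.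
      + by rewrite ltr_pdivrMr//; lra.
      + by rewrite ler_pdivlMr//; lra.
      + by move: h1; rewrite ltr_pdivrMr//; lra.
      + by move: h2; rewrite ler_pdivlMr//; lra.
    rewrite !lebesgue_measure_itv/= !lte_fin qp.
    rewrite ltr_pM2r ?invr_gt0// ltrD2r qp -!EFinD -EFinM gtr0_norm//.
    by congr EFin; field; rewrite gt_eqF.
transitivity (\int[mscale k (pushm mg mu)]_x f x)%E.
  by apply: eq_measure_integral => A mA _; exact: E.
rewrite ge0_integral_mscale//; congr (_ * _)%E.
by rewrite ge0_integral_pushm.
Qed.


Lemma normal_probE (m s : R) (B : set (measurableTypeR R)) : measurable B ->
  normal_prob m s B = (\int[mu]_x ((\1_B x)%:E * (normal_pdf m s x)%:E))%E.
Proof.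
move=> mB; rewrite /normal_prob integral_mkcond; apply: eq_integral => x _.
by rewrite patchE indicE; case: ifPn => _; rewrite ?mul1e ?mul0e.
Qed.

Lemma normal_peakE (s : R) : normal_peak s = `|s|^-1 * normal_peak 1.
Proof.
by rewrite /normal_peak -[in LHS]mulrnAr sqrtrM ?sqr_ge0// sqrtr_sqr invfM expr1n mul1r.
Qed.

(** Used with [s = -1] for the symmetry of the law, and with [s > 0] for the law of a nonzero linear
    form. *)
Lemma normal_prob_scale (s : R) (B : set (measurableTypeR R)) : s != 0 -> measurable B ->
  gam [set x | B (s * x)] = normal_prob 0 `|s| B.
Proof.
move=> s0 mB.
have ms : measurable_fun setT (fun x : measurableTypeR R => s * x : measurableTypeR R).
  exact: measurable_funM.
have mB' : measurable [set x : measurableTypeR R | B (s * x)].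
  by rewrite -[X in measurable X]setTI; exact: ms.
rewrite !normal_probE//.
have mp : measurable_fun setT (fun x : measurableTypeR R => ((\1_B x)%:E * (normal_pdf 0 `|s| x)%:E)%E).
  apply: emeasurable_funM; apply/measurable_EFinP => //.
  exact: measurable_normal_pdf.
rewrite [RHS](ge0_integral_affine (0) s0) => //; last first.
  by move=> x; rewrite -EFinM lee_fin mulr_ge0// normal_pdf_ge0.
rewrite -ge0_integralZl//=; last 2 first.
- apply: (measurableT_comp mp); apply: measurable_funD => //; exact: measurable_funM.
- by move=> x _; rewrite -EFinM lee_fin mulr_ge0// normal_pdf_ge0.
apply: eq_integral => x _; rewrite addr0 -!EFinM; congr EFin.
rewrite !indicE (_ : (x \in [set x0 | B (s * x0)]) = (s * x \in B)) //.
rewrite mulrCA; congr (_ * _).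
rewrite !normal_pdfE ?oner_eq0 ?normr_eq0// [in RHS]normal_peakE normr_id.
rewrite !mulrA mulfV ?normr_eq0// mul1r /normal_fun; congr (_ * expR _).
rewrite !subr0 expr1n real_normK ?num_real// !mulr2n; field.
by rewrite -mulr2n mulrn_eq0 sqrf_eq0.
Qed.

End NormalProb.

(** * Plane rotations and the second moment of the normal law *)

Section NormalRotation.
Context {R : realType}.
Local Notation mu := (@lebesgue_measure R).
Local Notation gam := (@normal_prob R 0 1).
Local Notation phi := (@normal_pdf R 0 1).

(* The rotation is undone by the substitution [y = (a - c x) / s], Tonelli, and [x = c a - s b]. *)
Lemma normal_prob_rotation (c s : R) (A B : set (measurableTypeR R)) :
  s != 0 -> c ^+ 2 + s ^+ 2 = 1 -> measurable A -> measurable B ->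
  ((gam \x gam) [set z | A (c * z.1 + s * z.2)%R /\ B (- s * z.1 + c * z.2)%R]
   = gam A * gam B)%E.
Proof.
move=> s0 cs mA mB.
pose f (z : measurableTypeR R * measurableTypeR R) : \bar R :=
  ((\1_A z.1)%:E * (phi z.1)%:E * ((\1_B z.2)%:E * (phi z.2)%:E))%E.
have f0 z : (0 <= f z)%E.
  by rewrite /f !mule_ge0// ?lee_fin// normal_pdf_ge0.
have mIA : measurable_fun setT (\1_A : measurableTypeR R -> R) by exact: measurable_indic.
have mIB : measurable_fun setT (\1_B : measurableTypeR R -> R) by exact: measurable_indic.
have mf : measurable_fun setT f.
  apply: emeasurable_funM; apply: emeasurable_funM; apply/measurable_EFinP.
  - exact: (measurableT_comp mIA measurable_fst).
  - exact: (measurableT_comp (measurable_normal_pdf 0 1) measurable_fst).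
  - exact: (measurableT_comp mIB measurable_snd).
  - exact: (measurableT_comp (measurable_normal_pdf 0 1) measurable_snd).
have mlin (p q : R) : measurable_fun setT (fun z : measurableTypeR R * measurableTypeR R =>
    p * z.1 + q * z.2 : measurableTypeR R).
  by apply: measurable_funD; apply: measurable_funM.
have mlin1 (p q : R) : measurable_fun setT (fun z : measurableTypeR R =>
    p * z + q : measurableTypeR R).
  by apply: measurable_funD => //; apply: measurable_funM.
pose E := [set z : measurableTypeR R * measurableTypeR R |
  A (c * z.1 + s * z.2)%R /\ B (- s * z.1 + c * z.2)%R].
have mE : measurable E.
  rewrite (_ : E = (fun z => c * z.1 + s * z.2) @^-1` A `&`
                   (fun z => - s * z.1 + c * z.2) @^-1` B) //.
  by apply: measurableI; rewrite -[X in measurable X]setTI; apply: mlin.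
have mIE : measurable_fun setT (fun z => (\1_E z)%:E : \bar R).
  by apply/measurable_EFinP.
pose F z := f (c * z.1 + s * z.2, - s * z.1 + c * z.2).
(* The product of the two densities depends only on [x^2 + y^2], which the rotation preserves. *)
have FE x y : F (x, y) = ((\1_E (x, y))%:E * (phi y)%:E * (phi x)%:E)%E.
  rewrite /F /f /= -!EFinM; congr EFin.
  have -> : \1_E (x, y) = \1_A (c * x + s * y) * \1_B (- s * x + c * y) :> R.
    rewrite !indicE -natrM mulnb; congr (_%:R); congr nat_of_bool.
    by apply/idP/andP; rewrite !inE.
  rewrite mulrACA -[RHS]mulrA; congr (_ * _).
  rewrite !normal_pdfE ?oner_eq0// /normal_fun mulrACA [RHS]mulrACA; congr (_ * _).
  rewrite -!expRD; congr expR; rewrite !subr0 expr1n -!mulrDl -!opprD; congr (- _ / _).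
  rewrite -[in RHS](mul1r (y ^+ 2)) -[in RHS](mul1r (x ^+ 2)) -cs; ring.
have mF : measurable_fun setT F.
  by apply: (measurableT_comp mf); apply/measurable_fun_pairP; split; exact: mlin.
have F0 z : (0 <= F z)%E by exact: f0.
transitivity (\int[gam \x gam]_z (\1_E z)%:E)%E.
  by rewrite -/E integral_indic; [rewrite setIT|exact: measurableT|exact: mE].
rewrite fubini_tonelli1//.
transitivity (\int[mu]_x \int[mu]_y F (x, y))%E.
  rewrite integral_normal_probE; last 2 first.
  - by apply: (measurable_fun_fubini_tonelli_F (m2 := gam)) => // z; rewrite lee_fin.
  - by move=> x; apply: integral_ge0 => y _; rewrite lee_fin.
  apply: eq_integral => x _.
  have mx : measurable_fun setT (fun y => (\1_E (x, y))%:E : \bar R).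
    exact: (measurableT_comp mIE (measurable_pair1 x)).
  rewrite /fubini_F integral_normal_probE//.
  rewrite -ge0_integralZr//; last 3 first.
  - apply: emeasurable_funM => //; apply/measurable_EFinP; exact: measurable_normal_pdf.
  - by move=> y _; rewrite mule_ge0// lee_fin normal_pdf_ge0.
  - by rewrite lee_fin normal_pdf_ge0.
  by apply: eq_integral => y _; rewrite FE.
pose K (z : measurableTypeR R * measurableTypeR R) := f (z.2, s^-1 * (c * z.2 - z.1)).
have mK : measurable_fun setT K.
  have m2 : measurable_fun setT (fun z : measurableTypeR R * measurableTypeR R =>
      s^-1 * (c * z.2 - z.1) : measurableTypeR R).
    rewrite (_ : (fun z => _) = (fun z => - s^-1 * z.1 + s^-1 * c * z.2)); first exact: mlin.
    by apply/funext => z /=; ring.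
  by apply: (measurableT_comp mf); apply/measurable_fun_pairP; split; [exact: measurable_snd|].
have K0 z : (0 <= K z)%E by exact: f0.
have si : `|s| != 0 by rewrite normr_eq0.
transitivity (\int[mu]_x (`|s|^-1%:E * \int[mu]_a K (x, a)))%E.
  apply: eq_integral => x _.
  have mKx : measurable_fun setT (fun a => K (x, a)).
    exact: (measurableT_comp mK (measurable_pair1 x)).
  rewrite (ge0_integral_affine (c * x) s0 mKx)//.
  rewrite muleA -EFinM mulVf// mul1e; apply: eq_integral => y _.
  rewrite /F /K /=; congr (f (_, _)); first by rewrite addrC.
  apply: (mulfI s0); rewrite mulrA mulfV// mul1r.
  rewrite -[X in _ = _ - X]mul1r -cs; ring.
rewrite ge0_integralZl; [|exact: measurableT
  |exact: (measurable_fun_fubini_tonelli_F (m2 := mu) K mK K0)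
  |by move=> x _; apply: integral_ge0 | by rewrite lee_fin invr_ge0].
rewrite (fubini_tonelli (m1 := mu) (m2 := mu) K)//.
rewrite -ge0_integralZl; [|exact: measurableT
  |exact: (measurable_fun_fubini_tonelli_G (m1 := mu) K mK K0)
  |by move=> x _; apply: integral_ge0 | by rewrite lee_fin invr_ge0].
transitivity (\int[mu]_a ((\1_A a)%:E * (phi a)%:E * gam B))%E.
  apply: eq_integral => a _.
  have mKa : measurable_fun setT (fun x => K (x, a)).
    exact: (measurableT_comp mK (measurable_pair2 a)).
  have ns0 : - s != 0 by rewrite oppr_eq0.
  rewrite (ge0_integral_affine (c * a) ns0 mKa)//.
  rewrite muleA -EFinM normrN mulVf// mul1e normal_probE// -ge0_integralZl; [|exact: measurableT
   |by apply: emeasurable_funM => //; apply/measurable_EFinP => //; exact: measurable_normal_pdf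
   |by move=> y _; rewrite mule_ge0// lee_fin// normal_pdf_ge0
   |by rewrite mule_ge0// lee_fin// normal_pdf_ge0].
  apply: eq_integral => y _; rewrite /K /f /=.
  rewrite (_ : s^-1 * _ = y) //.
  by apply: (mulfI s0); rewrite mulrA mulfV// mul1r; ring.
rewrite ge0_integralZr; [|exact: measurableT
   |by apply: emeasurable_funM => //; apply/measurable_EFinP => //; exact: measurable_normal_pdf
   |by move=> y _; rewrite mule_ge0// lee_fin// normal_pdf_ge0
   |exact: measure_ge0].
by rewrite (normal_probE _ _ mA).
Qed.

(* From [1 + (u/2) x^2 <= exp (u x^2 / 2)] integrated with [u = 1 - t^-2], [t > 1]. *)
Lemma normal_prob_sqr_le (t : R) : 1 < t ->
  (\int[gam]_x (x ^+ 2)%:E <= (2 * t ^+ 2 / (t + 1))%:E)%E.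
Proof.
move=> t1; have t0 : 0 < t by lra.
pose u := 1 - t ^- 2.
have u0 : 0 < u by rewrite subr_gt0 invf_lt1 ?exprn_gt0// expr_gt1// ltW.
have mx2 : measurable_fun setT (fun x : measurableTypeR R => (x ^+ 2)%:E : \bar R).
  by apply/measurable_EFinP; exact: measurable_funX.
have : (1 + (u / 2)%:E * \int[gam]_x (x ^+ 2)%:E <= t%:E)%E.
  have <- : (\int[gam]_x (1 + (u / 2)%:E * (x ^+ 2)%:E) =
             1 + (u / 2)%:E * \int[gam]_x (x ^+ 2)%:E)%E.
    rewrite ge0_integralD; [|exact: measurableT|by []|exact: measurable_cst
      |by move=> x _; rewrite -EFinM lee_fin mulr_ge0 ?sqr_ge0// divr_ge0// ltW
      |exact: emeasurable_funM].
    rewrite ge0_integralZl; [|exact: measurableT|exact: mx2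
      |by move=> x _; rewrite lee_fin sqr_ge0 |by rewrite lee_fin divr_ge0// ltW].
    by rewrite integral_cst// mul1e; congr (_ + _)%E; exact: (probability_setT (normal_prob 0 1)).
  rewrite integral_normal_probE//; last 2 first.
  - by apply: emeasurable_funD => //; exact: emeasurable_funM.
  - by move=> x; rewrite adde_ge0// -EFinM lee_fin mulr_ge0 ?sqr_ge0// divr_ge0// ltW.
  apply: (@le_trans _ _ (\int[mu]_x (t%:E * (normal_pdf 0 t x)%:E))%E); last first.
    rewrite ge0_integralZl; [|exact: measurableT
      |by apply/measurable_EFinP; exact: measurable_normal_pdf
      |by move=> x _; rewrite lee_fin normal_pdf_ge0 |by rewrite lee_fin ltW].
    by rewrite integral_normal_pdf mule1.
  apply: ge0_le_integral => //.
  - move=> x _; apply: mule_ge0; last by rewrite lee_fin normal_pdf_ge0.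
    by rewrite adde_ge0// -EFinM lee_fin mulr_ge0 ?sqr_ge0// divr_ge0// ltW.
  - apply: emeasurable_funM.
      by apply: emeasurable_funD => //; exact: emeasurable_funM.
    by apply/measurable_EFinP; exact: measurable_normal_pdf.
  - apply: emeasurable_funM => //.
    by apply/measurable_EFinP; exact: measurable_normal_pdf.
  move=> x _; rewrite (_ : 1 + _ = (1 + u / 2 * x ^+ 2)%:E)%E // -!EFinM lee_fin.
  rewrite !normal_pdfE ?oner_eq0 ?gt_eqF// /normal_fun !subr0.
  rewrite [in leRHS]normal_peakE (gtr0_norm t0) !mulrA mulfV ?gt_eqF// mul1r expr1n.
  rewrite (mulrC _ (normal_peak 1)) -!mulrA ler_wpM2l ?normal_peak_ge0//.
  rewrite (_ : - x ^+ 2 / (t ^+ 2 *+ 2) = u / 2 * x ^+ 2 + - x ^+ 2 / 2); last first.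
    by rewrite /u -mulr_natl; field; rewrite ?gt_eqF.
  rewrite expRD ler_wpM2r ?expR_ge0//; apply: le_trans (expR_ge1Dx _).
  by rewrite expr2 !mulrA.
have u2 : 0 < u / 2 by rewrite divr_gt0.
case: (\int[gam]_x _)%E => [r| |].
- rewrite -EFinM -EFinD !lee_fin => h.
  have {}h : r <= (t - 1) / (u / 2) by rewrite ler_pdivlMr// mulrC; lra.
  apply: (le_trans h); rewrite le_eqVlt; apply/orP; left; apply/eqP.
  have -> : u = (t - 1) * (t + 1) / t ^+ 2 by rewrite /u; field; rewrite gt_eqF.
  by field; do ?[apply/andP; split]; rewrite gt_eqF//; lra.
- by rewrite gt0_muley ?lte_fin.
- by rewrite leNye.
Qed.

(** An upper bound is all that is wanted, since the Lipschitz hypothesis asks for covariances below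
    [V] and its bound is monotone in the distance. *)
Lemma normal_prob_sqr_le1 : (\int[gam]_x (x ^+ 2)%:E <= 1)%E.
Proof.
apply/lee_addgt0Pr => e e0.
(* The bound [2 t^2 / (t + 1)] tends to 1 as [t] decreases to 1; this [t] keeps it below [1 + e]. *)
pose t := 1 + Num.min e 1 / 2.
have h : 0 < Num.min e 1 by rewrite lt_min e0 ltr01.
have h1 : Num.min e 1 <= 1 by rewrite ge_min lexx orbT.
have h2 : Num.min e 1 <= e by rewrite ge_min lexx.
have t1 : 1 < t by rewrite /t; lra.
apply: (le_trans (normal_prob_sqr_le t1)).
rewrite -EFinD lee_fin ler_pdivrMr; last by lra.
rewrite /t; set a := Num.min e 1 in h h1 h2 *; nra.
Qed.

End NormalRotation.

(** * Standard Gaussian vectors and coisometries *)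

Section Gstd.
Context {R : realType}.

Definition gam (B : set R) : R := fine (normal_prob 0 1 B).

Lemma gamE (B : set R) : measurable B -> normal_prob 0 1 B = (gam B)%:E.
Proof. by move=> mB; rewrite /gam fineK// fin_num_measure. Qed.

Lemma gamT : gam setT = 1.
Proof. by rewrite /gam /normal_prob integral_normal_pdf. Qed.

Definition vmeas d (T : measurableType d) n (U : T -> 'cV[R]_n) :=
  forall k, measurable_fun setT (fun w => U w k 0).

Definition box n (B : 'I_n -> set R) : set 'cV[R]_n := [set v | forall k, B k (v k 0)].

(* The coordinates of [U] are i.i.d. N(0,1) under [mu / c]; with masses [c <> 1] allowed,
   conditioning on an event is mere restriction of the measure. *)
Definition gstd d (T : measurableType d) (mu : {measure set T -> \bar R}) (c : R)
    n (U : T -> 'cV[R]_n) :=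
  vmeas U /\ forall B : 'I_n -> set R, (forall k, measurable (B k)) ->
    mu (U @^-1` box B) = (c * \prod_k gam (B k))%:E.

(** Quantifying over all spaces, measures and masses makes the property stable under block sums,
    where the measure is restricted to an event on the other block. *)
Definition good m n (A : 'M[R]_(m, n)) :=
  forall d (T : measurableType d) (mu : {measure set T -> \bar R}) c (U : T -> 'cV[R]_n),
    gstd mu c U -> gstd mu c (fun w => A *m U w).

Section meas.
Context d (T : measurableType d).

Lemma measurable_box n (U : T -> 'cV[R]_n) (B : 'I_n -> set R) :
  vmeas U -> (forall k, measurable (B k)) -> measurable (U @^-1` box B).
Proof.
move=> mU mB.
rewrite (_ : _ @^-1` _ = \bigcap_(k in [set: 'I_n]) ((fun w => U w k 0) @^-1` B k)).
  apply: fin_bigcap_measurable => [|k _]; first exact: finite_finset.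
  by rewrite -[X in measurable X]setTI; exact: mU.
apply/seteqP; split => w /= h k; first by move=> _; exact: h.
exact: (h k Logic.I).
Qed.

Lemma vmeas_mulmx m n (A : 'M[R]_(m, n)) (U : T -> 'cV[R]_n) :
  vmeas U -> vmeas (fun w => A *m U w).
Proof.
move=> mU k; under eq_fun do rewrite mxE.
by apply: measurable_sum => j; apply: measurable_funM.
Qed.

Lemma vmeas_col_mx m n (U1 : T -> 'cV[R]_m) (U2 : T -> 'cV[R]_n) :
  vmeas U1 -> vmeas U2 -> vmeas (fun w => col_mx (U1 w) (U2 w)).
Proof.
move=> m1 m2 k; case: (split_ordP k) => j ->.
  by under eq_fun do rewrite col_mxEu; exact: m1.
by under eq_fun do rewrite col_mxEd; exact: m2.
Qed.

Lemma vmeas_usub m n (U : T -> 'cV[R]_(m + n)) : vmeas U -> vmeas (fun w => usubmx (U w)).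
Proof. by move=> mU k; under eq_fun do rewrite mxE; exact: mU. Qed.

Lemma vmeas_dsub m n (U : T -> 'cV[R]_(m + n)) : vmeas U -> vmeas (fun w => dsubmx (U w)).
Proof. by move=> mU k; under eq_fun do rewrite mxE; exact: mU. Qed.

Definition box_cat m n (B1 : 'I_m -> set R) (B2 : 'I_n -> set R) (k : 'I_(m + n)) : set R :=
  match fintype.split k with inl i => B1 i | inr j => B2 j end.

Lemma box_catl m n (B1 : 'I_m -> set R) (B2 : 'I_n -> set R) i :
  box_cat B1 B2 (lshift n i) = B1 i.
Proof.
rewrite /box_cat; case: split_ordP => j; first by move/lshift_inj ->.
by move/eqP; rewrite eq_lrshift.
Qed.

Lemma box_catr m n (B1 : 'I_m -> set R) (B2 : 'I_n -> set R) i :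
  box_cat B1 B2 (rshift m i) = B2 i.
Proof.
rewrite /box_cat; case: split_ordP => j; last by move/rshift_inj ->.
by move/esym/eqP; rewrite eq_lrshift.
Qed.

Lemma measurable_box_cat m n (B1 : 'I_m -> set R) (B2 : 'I_n -> set R) :
  (forall k, measurable (B1 k)) -> (forall k, measurable (B2 k)) ->
  forall k, measurable (box_cat B1 B2 k).
Proof. by move=> m1 m2 k; rewrite /box_cat; case: (fintype.split k). Qed.

Lemma box_split m n (B : 'I_(m + n) -> set R) (v : 'cV[R]_(m + n)) :
  box B v <-> box (fun i => B (lshift n i)) (usubmx v) /\
              box (fun i => B (rshift m i)) (dsubmx v).
Proof.
split=> [h|h k]; first by split => k; rewrite mxE; exact: h.
case: h => h1 h2; case: (split_ordP k) => j ->; first by have := h1 j; rewrite mxE.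
by have := h2 j; rewrite mxE.
Qed.

Variable mu : {measure set T -> \bar R}.
Variable c : R.

(** Independence of the two blocks, in the form used for conditioning: restricting to a box event on
    one block only changes the total mass seen by the other. *)
Lemma gstd_restr_u m n (U : T -> 'cV[R]_(m + n)) (B2 : 'I_n -> set R)
    (mD : measurable ((fun w => dsubmx (U w)) @^-1` box B2)) :
  (forall k, measurable (B2 k)) -> gstd mu c U ->
  gstd (mrestr mu mD) (c * \prod_k gam (B2 k)) (fun w => usubmx (U w)).
Proof.
move=> mB2 [mU hU]; split => [|B1 mB1]; first exact: vmeas_usub.
rewrite /= /mrestr.
have := hU _ (measurable_box_cat mB1 mB2); rewrite big_split_ord /=.
under eq_bigr do rewrite box_catl.
under [X in _ * (_ * X)]eq_bigr do rewrite box_catr.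
rewrite [X in _ * X]mulrC mulrA => <-; congr (mu _).
apply/seteqP; split => w /=.
  by move=> [h1 h2]; apply/box_split; split => k; rewrite (box_catl, box_catr); [exact: h1|exact: h2].
by move=> /box_split[h1 h2]; split => k; [have := h1 k | have := h2 k]; rewrite (box_catl, box_catr).
Qed.

Lemma gstd_restr_d m n (U : T -> 'cV[R]_(m + n)) (B1 : 'I_m -> set R)
    (mD : measurable ((fun w => usubmx (U w)) @^-1` box B1)) :
  (forall k, measurable (B1 k)) -> gstd mu c U ->
  gstd (mrestr mu mD) (c * \prod_k gam (B1 k)) (fun w => dsubmx (U w)).
Proof.
move=> mB1 [mU hU]; split => [|B2 mB2]; first exact: vmeas_dsub.
rewrite /= /mrestr.
have := hU _ (measurable_box_cat mB1 mB2); rewrite big_split_ord /=.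
under eq_bigr do rewrite box_catl.
under [X in _ * (_ * X)]eq_bigr do rewrite box_catr.
rewrite mulrA => <-; congr (mu _).
apply/seteqP; split => w /=.
  by move=> [h2 h1]; apply/box_split; split => k; rewrite (box_catl, box_catr); [exact: h1|exact: h2].
by move=> /box_split[h1 h2]; split => k; [have := h2 k | have := h1 k]; rewrite (box_catl, box_catr).
Qed.

Lemma gstd_usub m n (U : T -> 'cV[R]_(m + n)) :
  gstd mu c U -> gstd mu c (fun w => usubmx (U w)).
Proof.
move=> hU; have mT := fun k : 'I_n => @measurableT _ R.
have [mU' hU'] := gstd_restr_u (measurable_box (vmeas_dsub hU.1) mT) mT hU.
split => // B mB; have := hU' B mB; rewrite /= /mrestr => H.
move: H; rewrite [in X in X -> _](big1 _ (fun k : 'I_n => true)); last by move=> k _; exact: gamT.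
by rewrite mulr1 => <-; congr (mu _); apply/seteqP; split => w //= [].
Qed.

Lemma gstd_dsub m n (U : T -> 'cV[R]_(m + n)) :
  gstd mu c U -> gstd mu c (fun w => dsubmx (U w)).
Proof.
move=> hU; have mT := fun k : 'I_m => @measurableT _ R.
have [mU' hU'] := gstd_restr_d (measurable_box (vmeas_usub hU.1) mT) mT hU.
split => // B mB; have := hU' B mB; rewrite /= /mrestr => H.
move: H; rewrite [in X in X -> _](big1 _ (fun k : 'I_m => true)); last by move=> k _; exact: gamT.
by rewrite mulr1 => <-; congr (mu _); apply/seteqP; split => w //= [].
Qed.

End meas.

Lemma good_mul m n p (A : 'M[R]_(m, n)) (B : 'M[R]_(n, p)) :
  good A -> good B -> good (A *m B).
Proof.
move=> gA gB d T mu c U hU.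
rewrite (_ : (fun w => _) = (fun w => A *m (B *m U w))); first exact/gA/gB.
by apply/funext => w; rewrite mulmxA.
Qed.

Lemma good1 n : good (1%:M : 'M[R]_n).
Proof. by move=> d T mu c U; rewrite (_ : (fun w => _) = U)//; apply/funext => w; rewrite mul1mx. Qed.

(** Once the measure is restricted to a box event on the lower block, the upper block is still
    standard Gaussian, so [good A] applies to the restricted measure. *)
Lemma good_block_l m m' n (A : 'M[R]_(m', m)) : good A ->
  good (block_mx A 0 0 1%:M : 'M[R]_(m' + n, m + n)).
Proof.
move=> gA d T mu c U hU.
have mAU := vmeas_mulmx (block_mx A 0 0 1%:M : 'M[R]_(m' + n, m + n)) hU.1.
split=> // B mB.
have mB2 k : measurable (B (rshift m' k)) by [].
have [_ h] := gA _ _ _ _ _ (gstd_restr_u (measurable_box (vmeas_dsub hU.1) mB2) mB2 hU).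
have := h (fun i => B (lshift n i)) (fun i => mB _).
rewrite /= /mrestr => H; rewrite big_split_ord/= [X in c * X]mulrC mulrA -H; congr (mu _).
apply/seteqP; split => w /=.
  by move/box_split; rewrite -[U w]vsubmxK mul_block_col !mul0mx add0r mul1mx addr0 !col_mxKu !col_mxKd.
move=> h'; apply/box_split.
by rewrite -[U w]vsubmxK mul_block_col !mul0mx add0r mul1mx addr0 !col_mxKu !col_mxKd.
Qed.

Lemma good_block_r m n n' (A : 'M[R]_(n', n)) : good A ->
  good (block_mx 1%:M 0 0 A : 'M[R]_(m + n', m + n)).
Proof.
move=> gA d T mu c U hU.
have mAU := vmeas_mulmx (block_mx 1%:M 0 0 A : 'M[R]_(m + n', m + n)) hU.1.
split=> // B mB.
have mB1 k : measurable (B (lshift n' k)) by [].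
have [_ h] := gA _ _ _ _ _ (gstd_restr_d (measurable_box (vmeas_usub hU.1) mB1) mB1 hU).
have := h (fun i => B (rshift m i)) (fun i => mB _).
rewrite /= /mrestr => H; rewrite big_split_ord/= mulrA -H; congr (mu _).
apply/seteqP; split => w /=.
  by move/box_split; rewrite -[U w]vsubmxK mul_block_col !mul0mx add0r mul1mx addr0 !col_mxKu !col_mxKd => -[].
move=> [h1 h2]; apply/box_split; move: h1 h2.
by rewrite -[U w]vsubmxK mul_block_col !mul0mx add0r mul1mx addr0 !col_mxKu !col_mxKd.
Qed.

Lemma good_block m m' n n' (A : 'M[R]_(m', m)) (B : 'M[R]_(n', n)) : good A -> good B ->
  good (block_mx A 0 0 B).
Proof.
move=> gA gB.
rewrite (_ : block_mx _ _ _ _ = block_mx A 0 0 1%:M *m block_mx 1%:M 0 0 B).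
  by apply: good_mul; [exact: good_block_l|exact: good_block_r].
by rewrite mulmx_block !mulmx0 !mul0mx mulmx1 mul1mx !addr0 !add0r.
Qed.

End Gstd.

Lemma pushmE (R : realType) d1 d2 (T1 : measurableType d1) (T2 : measurableType d2)
  (f : T1 -> T2) (mf : measurable_fun setT f) (mu : {measure set T1 -> \bar R}) A :
  pushm mf mu A = mu (f @^-1` A).
Proof. by []. Qed.

(** * Coisometries preserve standard Gaussian vectors *)

Section Good.
Context {R : realType}.

Definition rot (c s : R) : 'M[R]_2 :=
  \matrix_(i, j) (if i == 0 then (if j == 0 then c else s)
                  else (if j == 0 then - s else c)).

Lemma gstd_mass d (T : measurableType d) (mu : {measure set T -> \bar R}) c n
  (U : T -> 'cV[R]_n) : gstd mu c U -> mu setT = c%:E.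
Proof.
move=> [_ h]; have := h (fun=> setT) (fun=> measurableT).
rewrite big1 ?mulr1; last by move=> k _; exact: gamT.
by move=> <-; congr (mu _); apply/seteqP; split.
Qed.

(** Divided by its mass, the law of the two coordinates agrees with the product of two normal laws
    on rectangles, hence everywhere, so [normal_prob_rotation] applies. *)
Lemma good_rot (c s : R) : s != 0 -> c ^+ 2 + s ^+ 2 = 1 -> good (rot c s).
Proof.
move=> s0 cs d T mu e U hU; have [mU h] := hU.
have mass := gstd_mass hU.
have e0 : 0 <= e by rewrite -lee_fin -mass measure_ge0.
split=> [|B mB]; first exact: vmeas_mulmx.
have mRU := measurable_box (vmeas_mulmx (rot c s) mU) mB.
(* With mass zero there is nothing to normalise, and both sides vanish. *)
move: e0; rewrite le_eqVlt => /orP[/eqP e0|e0].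
  rewrite -e0 mul0r; apply/eqP; rewrite eq_le measure_ge0 andbT.
  have -> : 0%:E = mu setT by rewrite mass -e0.
  by apply: le_measure; rewrite ?inE.
pose p w : measurableTypeR R * measurableTypeR R := (U w 0 0, U w 1 0).
have mp : measurable_fun setT p.
  by apply/measurable_fun_pairP; split; [exact: (mU 0)|exact: (mU 1)].
have ei : 0 <= e^-1 by rewrite invr_ge0 ltW.
pose m' := mscale (NngNum ei) (pushm mp mu).
pose E := [set z : measurableTypeR R * measurableTypeR R |
  B 0 (c * z.1 + s * z.2)%R /\ B 1 (- s * z.1 + c * z.2)%R].
have mlin (a b : R) : measurable_fun setT (fun z : measurableTypeR R * measurableTypeR R =>
    a * z.1 + b * z.2 : measurableTypeR R).
  by apply: measurable_funD; apply: measurable_funM.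
have mE : measurable E.
  rewrite (_ : E = (fun z => c * z.1 + s * z.2) @^-1` B 0 `&`
                   (fun z => - s * z.1 + c * z.2) @^-1` B 1) //.
  apply: measurableI; rewrite -[X in measurable X]setTI; apply: mlin => //; exact: mB.
have I2 (k : 'I_2) : k = 0 \/ k = 1.
  by case: k => -[|[|]] // ?; [left|right]; apply: val_inj.
have Bp (A : 'I_2 -> set R) : \prod_k gam (A k) = gam (A 0) * gam (A 1).
  by rewrite !big_ord_recl big_ord0 mulr1; congr (_ * gam (A _)); apply: val_inj.
have H : (normal_prob 0 1 \x normal_prob 0 1)%E E = m' E.
  apply: product_measure_unique => // A1 A2 mA1 mA2.
  rewrite /m' /= /mscale pushmE.
  pose A (k : 'I_2) := if k == 0 then A1 else A2.
  have mA k : measurable (A k) by rewrite /A; case: ifP.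
  transitivity ((e^-1)%:E * mu (U @^-1` box A))%E.
    congr (_ * mu _)%E; apply/seteqP; split => w /=.
      by move=> [h1 h2] k; case: (I2 k) => ->.
    by move=> hw; split; [exact: (hw 0)|exact: (hw 1)].
  by rewrite h// Bp -EFinM mulKf ?gt_eqF// EFinM !gamE.
move: H; rewrite normal_prob_rotation; [|exact: s0|exact: cs|exact: mB|exact: mB].
rewrite /m' /= /mscale pushmE !gamE//= => H.
rewrite Bp.
have -> : (fun w => rot c s *m U w) @^-1` box B = p @^-1` E.
  have RU w : (rot c s *m U w) 0 0 = c * U w 0 0 + s * U w 1 0 /\
              (rot c s *m U w) 1 0 = - s * U w 0 0 + c * U w 1 0.
    split; rewrite !mxE !big_ord_recl big_ord0 !mxE /= addr0;
    by congr (_ * U w _ 0 + _ * U w _ 0); apply: val_inj.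
  apply/seteqP; split => w /=.
    by move=> hw; have := hw 0; have := hw 1; rewrite (RU w).1 (RU w).2.
  by move=> [h1 h2] k; case: (I2 k) => ->; rewrite ((RU w).1, (RU w).2).
rewrite EFinM [(gam _ * gam _)%:E]EFinM [X in (_ * X)%E]H muleA -EFinM.
by rewrite mulfV ?gt_eqF// mul1e.
Qed.

(** The elimination leaves a corner entry [r] with [r^2 = 1]; this settles the case [r = -1]. *)
Lemma good_opp1 : good (- 1%:M : 'M[R]_1).
Proof.
move=> d T mu e U hU; have [mU h] := hU.
split=> [|B mB]; first exact: vmeas_mulmx.
have n1 : (-1 : R) != 0 by rewrite oppr_eq0 oner_eq0.
have mB' k : measurable [set x : R | B k (- 1 * x)].
  have mm : measurable_fun setT (fun x : R => - 1 * x) by exact: measurable_funM.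
  by rewrite -[X in measurable X]setTI; exact: mm.
have E k : gam (B k) = gam [set x : R | B k (- 1 * x)].
  apply: EFin_inj; rewrite -!gamE//.
  by rewrite (normal_prob_scale n1 (mB k)) normrN1.
under [in RHS]eq_bigr do rewrite E.
rewrite -h//; congr (mu _); apply/seteqP; split => w /= hw k; have := hw k => /=.
  by rewrite mulNmx mul1mx mxE mulN1r.
by rewrite mulNmx mul1mx mxE mulN1r.
Qed.

Lemma row2P N (u v : 'rV[R]_(2 + N)) : u 0 0 = v 0 0 -> u 0 1 = v 0 1 ->
  (forall j, u 0 (rshift 2 j) = v 0 (rshift 2 j)) -> u = v.
Proof.
move=> h0 h1 h2; apply/rowP => i; case: (split_ordP i) => j -> //.
case: j => -[|[|]] // lt2.
  have -> : lshift N (Ordinal lt2) = (0 : 'I_N.+2) by apply: val_inj.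
  exact: h0.
have -> : lshift N (Ordinal lt2) = (1 : 'I_N.+2) by apply: val_inj.
exact: h1.
Qed.

(* Givens elimination: plane rotations gather all of [a] in its first coordinate. *)
Lemma exists_good_elim N (a : 'rV[R]_N.+1) :
  exists O : 'M[R]_N.+1, [/\ good O, O *m O^T = 1%:M &
    exists r, a *m O^T = r *: delta_mx 0 0].
Proof.
elim: N => [|N IH] in a *.
  exists 1%:M; split; [exact: good1|by rewrite trmx1 mulmx1|exists (a 0 0)].
  rewrite trmx1 mulmx1; apply/rowP => i; rewrite !mxE !ord1 eqxx mulr1//.
have [Op [gOp OOp [r hr]]] := IH (rsubmx (a : 'rV_(1 + N.+1))).
pose Q1 : 'M[R]_(1 + N.+1) := block_mx 1%:M 0 0 Op.
have gQ1 : good Q1 by exact: good_block_r.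
have Q1T : Q1^T = block_mx 1%:M 0 0 Op^T by rewrite tr_block_mx !trmx0 trmx1.
have QQ1 : Q1 *m Q1^T = 1%:M.
  rewrite Q1T mulmx_block !mulmx0 !mul0mx mulmx1 OOp !addr0 !add0r.
  by rewrite -scalar_mx_block.
(* The dimension [1 + N.+1] separates the first coordinate from the tail treated by induction; the
   convertible [2 + N] isolates the plane to be rotated. *)
pose b : 'rV[R]_(2 + N) := (a : 'rV_(1 + N.+1)) *m Q1^T.
pose x := a 0 0.
have bE : b = (row_mx (x%:M : 'rV_1) (r *: delta_mx 0 0) : 'rV_(1 + N.+1)).
  have aE := esym (hsubmxK (a : 'rV_(1 + N.+1))).
  rewrite /b Q1T [X in X *m _]aE mul_row_block !mulmx0 addr0 add0r mulmx1 hr.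
  rewrite (_ : lsubmx _ = x%:M)//; apply/rowP => i; rewrite !mxE !ord1 /x mulr1n; congr (a _ _); exact: val_inj.
have b0 : b 0 0 = x.
  have := row_mxEl (x%:M : 'rV_1) (r *: delta_mx 0 0 : 'rV_N.+1) 0 0.
  by rewrite [RHS]mxE mulr1n bE => H; rewrite -[RHS]H; congr (fun_of_matrix _ _ _); apply: val_inj.
have b1 : b 0 1 = r.
  have := row_mxEr (x%:M : 'rV_1) (r *: delta_mx 0 0 : 'rV_N.+1) 0 0.
  rewrite [RHS]mxE [in RHS]mxE !eqxx mulr1 bE => H; rewrite -[RHS]H.
  by congr (fun_of_matrix _ _ _); apply: val_inj.
have b2 j : b 0 (rshift 2 j) = 0.
  have := row_mxEr (x%:M : 'rV_1) (r *: delta_mx 0 0 : 'rV_N.+1) 0 (lift ord0 j).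
  rewrite [RHS]mxE [in RHS]mxE mulr0 bE => H; rewrite -[RHS]H.
  by congr (fun_of_matrix _ _ _); apply: val_inj.
(* The rotation below has sine [r / rho], which [good_rot] wants nonzero; if [r = 0], everything
   already sits in the first coordinate. *)
have [r0|r0] := eqVneq r 0.
  exists Q1; split => //; exists x.
  rewrite -/b; apply: row2P => [||j]; rewrite (b0, b1, b2) !mxE /= ?eqxx ?r0 ?mulr1 ?mulr0//.
pose rho := Num.sqrt (x ^+ 2 + r ^+ 2).
have xr : 0 < x ^+ 2 + r ^+ 2 by rewrite ltr_wpDl ?sqr_ge0// exprn_even_gt0.
have rho0 : 0 < rho by rewrite sqrtr_gt0.
have rho2 : rho ^+ 2 = x ^+ 2 + r ^+ 2 by rewrite sqr_sqrtr ?ltW.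
pose c := x / rho; pose s := r / rho.
have cs : c ^+ 2 + s ^+ 2 = 1.
  by rewrite /c /s !expr_div_n -mulrDl rho2 mulfV ?gt_eqF.
have s0 : s != 0 by apply: mulf_neq0 => //; rewrite invr_eq0 gt_eqF.
pose Q2 : 'M[R]_(2 + N) := block_mx (rot c s) 0 0 1%:M.
have gQ2 : good Q2 by apply: good_block_l; exact: good_rot.
have Q2T : Q2^T = block_mx (rot c s)^T 0 0 1%:M by rewrite tr_block_mx !trmx0 trmx1.
have RR : rot c s *m (rot c s)^T = 1%:M.
  apply/matrixP => i j; rewrite !mxE !big_ord_recl big_ord0 !mxE /=.
  case: i => -[|[|]] // ?; case: j => -[|[|]] // ?; rewrite /= ?mulr1n ?mulr0n addr0.
  - by rewrite -!expr2.
  - ring.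
  - ring.
  - by rewrite mulrNN -!expr2 addrC.
have QQ2 : Q2 *m Q2^T = 1%:M.
  rewrite Q2T mulmx_block !mulmx0 !mul0mx mulmx1 RR !addr0 !add0r.
  by rewrite -scalar_mx_block.
exists (Q2 *m Q1); split; first exact: good_mul.
  by rewrite trmx_mul mulmxA -(mulmxA Q2) QQ1 mulmx1.
exists rho; rewrite trmx_mul mulmxA -/b.
have rb : rsubmx b = 0 by apply/rowP => j; rewrite mxE b2 mxE.
pose w := row_mx (lsubmx b *m (rot c s)^T) 0 : 'rV[R]_(2 + N).
have bQ : b *m Q2^T = w.
  rewrite -{1}(hsubmxK b) rb Q2T (mul_row_block (lsubmx b)).
  by rewrite !mulmx0 !mul0mx !addr0.
have wl i : w 0 (lshift N i) = b 0 0 * (rot c s) i 0 + b 0 1 * (rot c s) i 1.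
  have e0 : lsubmx b 0 ord0 = b 0 0 by rewrite mxE; congr (b _ _); apply: val_inj.
  have e1 : lsubmx b 0 (lift ord0 ord0) = b 0 1 by rewrite mxE; congr (b _ _); apply: val_inj.
  have e2 : lift ord0 ord0 = 1 :> 'I_2 by apply: val_inj.
  rewrite row_mxEl mxE !big_ord_recl big_ord0 addr0 e0 e1 e2.
  by rewrite ![(rot c s)^T _ _]mxE.
transitivity w; first exact: bQ.
apply: row2P => [||j].
- rewrite (_ : w 0 0 = w 0 (lshift N 0)); last by congr (w _ _); apply: val_inj.
  rewrite wl b0 b1 !mxE /= mulr1 /c /s mulrA [r * _]mulrA -mulrDl -!expr2 -rho2.
  by rewrite expr2 mulfK ?gt_eqF.
- rewrite (_ : w 0 1 = w 0 (lshift N 1)); last by congr (w _ _); apply: val_inj.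
  by rewrite wl b0 b1 !mxE /= mulr0 /c /s; ring.
by rewrite row_mxEr !mxE mulr0.
Qed.

(** Induction on the rows. After an orthogonal change of variables the first row is [r e_0], and its
    norm gives [r^2 = 1]. Orthogonality to the other rows then clears the first column below the
    corner, so the matrix splits into [r] and a smaller coisometry. *)
Lemma good_coisometry n N (A : 'M[R]_(n, N)) : A *m A^T = 1%:M -> good A.
Proof.
elim: n => [|n IH] in N A *.
  move=> _ d T mu c U hU; split=> [|B mB]; first by case.
  rewrite big_ord0 mulr1 -(gstd_mass hU); congr (mu _).
  by apply/seteqP; split => // w _ [].
case: N => [|N] in A *.
  move=> /matrixP/(_ 0 0); rewrite !mxE big_ord0 => /eqP.
  by rewrite eq_sym oner_eq0.
move=> AA.
have [Om [gO OO [r hr]]] := exists_good_elim (row 0 A).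
have OtO : Om^T *m Om = 1%:M by exact: mulmx1C.
pose C : 'M[R]_(1 + n, 1 + N) := A *m Om^T.
have CC : C *m C^T = 1%:M.
  by rewrite /C trmx_mul trmxK mulmxA -(mulmxA A) OtO mulmx1.
have AE : A = C *m Om by rewrite /C -mulmxA OtO mulmx1.
have rC : row 0 C = r *: delta_mx 0 0 by rewrite row_mul hr.
clearbody C.
have Cur : ursubmx C = 0.
  apply/matrixP => i j; rewrite !mxE ord1; have /rowP/(_ (rshift 1 j)) := rC.
  by rewrite !mxE /= mulr0 => H; rewrite -[RHS]H; congr (C _ _); apply: val_inj.
have Cul : ulsubmx C = r%:M.
  apply/matrixP => i j; rewrite !mxE !ord1; have /rowP/(_ 0) := rC.
  by rewrite !mxE eqxx mulr1 mulr1n => H; rewrite -[RHS]H; congr (C _ _); apply: val_inj.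
move: CC; rewrite -[C]submxK Cur Cul tr_block_mx mulmx_block.
rewrite trmx0 !mul0mx !mulmx0 !addr0 tr_scalar_mx -scalar_mxM scalar_mx_block.
move=> /eq_block_mx[h1 h2 h3 h4].
have r2 : r * r = 1.
  by move: h1 => /matrixP/(_ 0 0); rewrite !mxE mulr1n.
have r0 : r != 0 by apply/eqP => r0; move: r2; rewrite r0 mul0r => /eqP; rewrite eq_sym oner_eq0.
have Cdl : dlsubmx C = 0.
  move: h3; rewrite mul_mx_scalar => /eqP; rewrite scaler_eq0 (negbTE r0) /=.
  by move/eqP.
have gdr : good (drsubmx C).
  by apply: IH; move: h4; rewrite Cdl mul0mx add0r.
have gr : good (r%:M : 'M[R]_1).
  have : r ^+ 2 == 1 by rewrite expr2 r2.
  rewrite sqrf_eq1 => /orP[/eqP->|/eqP->]; first exact: good1.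
  by rewrite (_ : (-1)%:M = - 1%:M); [exact: good_opp1|rewrite raddfN].
have CE : C = block_mx r%:M 0 0 (drsubmx C) by rewrite -[LHS]submxK Cur Cul Cdl.
by rewrite AE CE; apply: good_mul => //; exact: (good_block gr gdr).
Qed.

End Good.

(** * Square-integrable random variables *)

Section L2.
Context {R : realType} {d : measure_display} {T : measurableType d} (P : probability T R).
Implicit Types f g : T -> R.

Definition itg f := P.-integrable setT (EFin \o f).

Definition L2 f := measurable_fun setT f /\ itg (fun w => f w ^+ 2).

Lemma L2P f : measurable_fun setT f -> (\int[P]_w (f w ^+ 2)%:E < +oo)%E -> L2 f.
Proof.
move=> mf hf; split => //; apply/integrableP; split.
  by apply/measurable_EFinP; exact: measurable_funX.
by under eq_integral do rewrite /= ger0_norm ?sqr_ge0//.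
Qed.

Lemma Ex_ge0 f : (forall w, 0 <= f w) -> 0 <= Ex P f.
Proof. by move=> f0; apply: fine_ge0; apply: integral_ge0 => w _; rewrite lee_fin. Qed.

Lemma ExE f : itg f -> (\int[P]_w (f w)%:E)%E = (Ex P f)%:E.
Proof. by move=> h; rewrite /Ex fineK//; exact: (integrable_fin_num measurableT h). Qed.

Lemma itgD f g : itg f -> itg g -> itg (fun w => f w + g w).
Proof.
move=> hf hg; rewrite /itg (_ : EFin \o _ = (fun w => (EFin \o f) w + (EFin \o g) w)%E)//.
exact: integrableD.
Qed.

Lemma itgZ a f : itg f -> itg (fun w => a * f w).
Proof. by move=> hf; rewrite /itg (_ : EFin \o _ = (fun w => a%:E * (EFin \o f) w)%E)//; exact: integrableZl. Qed.

Lemma itg_cst a : itg (fun=> a).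
Proof. exact: finite_measure_integrable_cst. Qed.

Lemma itg_sum (I : Type) (s : seq I) (f : I -> T -> R) : (forall i, itg (f i)) ->
  itg (fun w => \sum_(i <- s) f i w).
Proof.
move=> hf; elim: s => [|i s IH].
  by under eq_fun do rewrite big_nil; exact: itg_cst.
by under eq_fun do rewrite big_cons; exact: itgD.
Qed.

Lemma ExD f g : itg f -> itg g -> Ex P (fun w => f w + g w) = Ex P f + Ex P g.
Proof.
move=> hf hg; apply: EFin_inj; rewrite -ExE; last exact: itgD.
by under eq_integral do rewrite EFinD; rewrite integralD// EFinD !ExE.
Qed.

Lemma ExZ a f : itg f -> Ex P (fun w => a * f w) = a * Ex P f.
Proof.
move=> hf; apply: EFin_inj; rewrite -ExE; last exact: itgZ.
by under eq_integral do rewrite EFinM; rewrite integralZl// EFinM ExE.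
Qed.

Lemma Ex_cst a : Ex P (fun=> a) = a.
Proof.
rewrite /Ex (_ : (\int[P]_w a%:E)%E = a%:E)//.
by rewrite -[RHS]mule1 -(probability_setT P) -integral_cst.
Qed.

Lemma ExB f g : itg f -> itg g -> Ex P (fun w => f w - g w) = Ex P f - Ex P g.
Proof.
move=> hf hg; rewrite -[- Ex P g]mulN1r -ExZ// -ExD//; last exact: itgZ.
by congr Ex; apply/funext => w; rewrite mulN1r.
Qed.

Lemma Ex_sum (I : Type) (s : seq I) (f : I -> T -> R) : (forall i, itg (f i)) ->
  Ex P (fun w => \sum_(i <- s) f i w) = \sum_(i <- s) Ex P (f i).
Proof.
move=> hf; elim: s => [|i s IH].
  by under eq_fun do rewrite big_nil; rewrite big_nil Ex_cst.
by under eq_fun do rewrite big_cons; rewrite big_cons ExD ?IH//; exact: itg_sum.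
Qed.

Lemma itg_le f g : measurable_fun setT f -> itg g -> (forall w, `|f w| <= g w) -> itg f.
Proof.
move=> mf hg fg; apply: (le_integrable _ _ _ hg) => //.
  exact/measurable_EFinP.
move=> w _ /=; rewrite lee_fin (le_trans (fg w))// ler_norm//.
Qed.

Lemma itgM f g : L2 f -> L2 g -> itg (fun w => f w * g w).
Proof.
move=> [mf hf] [mg hg].
apply: (@itg_le _ (fun w => f w ^+ 2 + g w ^+ 2)); first exact: measurable_funM.
  exact: itgD.
move=> w; have h1 := sqr_ge0 (f w + g w); have h2 := sqr_ge0 (f w - g w).
rewrite ler_norml; apply/andP; split; nra.
Qed.

Lemma L2_cst a : L2 (fun=> a).
Proof. by split; [exact: measurable_cst|exact: itg_cst]. Qed.

Lemma L2_itg f : L2 f -> itg f.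
Proof.
move=> hf; have := itgM hf (L2_cst 1).
by under eq_fun do rewrite mulr1.
Qed.

Lemma L2D f g : L2 f -> L2 g -> L2 (fun w => f w + g w).
Proof.
move=> hf hg; split; first exact: measurable_funD hf.1 hg.1.
rewrite (_ : (fun w => _) = (fun w => f w ^+ 2 + g w ^+ 2 + 2 * (f w * g w))); last first.
  by apply/funext => w; ring.
by apply: itgD; [apply: itgD; [exact: hf.2|exact: hg.2]|apply: itgZ; exact: itgM].
Qed.

Lemma L2Z a f : L2 f -> L2 (fun w => a * f w).
Proof.
move=> hf; split; first exact: measurable_funM hf.1.
under eq_fun do rewrite exprMn.
by apply: itgZ; exact: hf.2.
Qed.

Lemma L2B f g : L2 f -> L2 g -> L2 (fun w => f w - g w).
Proof.
move=> hf /(L2Z (-1)) hg; have := L2D hf hg.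
by under eq_fun do rewrite mulN1r.
Qed.

Lemma L2_sum (I : Type) (s : seq I) (f : I -> T -> R) : (forall i, L2 (f i)) ->
  L2 (fun w => \sum_(i <- s) f i w).
Proof.
move=> hf; elim: s => [|i s IH].
  by under eq_fun do rewrite big_nil; exact: L2_cst.
by under eq_fun do rewrite big_cons; exact: L2D.
Qed.

Lemma Ex_sqrD f g : L2 f -> L2 g -> Ex P (fun w => (f w + g w) ^+ 2) =
  Ex P (fun w => f w ^+ 2) + 2 * Ex P (fun w => f w * g w) + Ex P (fun w => g w ^+ 2).
Proof.
move=> hf hg.
rewrite (_ : (fun w => _) = (fun w => f w ^+ 2 + 2 * (f w * g w) + g w ^+ 2)); last first.
  by apply/funext => w; ring.
have i1 := hf.2; have i2 := hg.2; have i3 := itgZ 2 (itgM hf hg).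
by rewrite ExD//; [rewrite ExD// ExZ//; exact: itgM|exact: itgD].
Qed.

(** Conditioning and changes of law are proved for nonnegative integrands; polarization transfers
    them from squares to products. *)
Lemma Ex_polar f g : L2 f -> L2 g -> Ex P (fun w => f w * g w) =
  (Ex P (fun w => (f w + g w) ^+ 2) - Ex P (fun w => (f w - g w) ^+ 2)) / 4.
Proof.
move=> hf hg; rewrite -ExB; last 2 first.
- exact: (L2D hf hg).2.
- exact: (L2B hf hg).2.
rewrite (_ : (fun w => _ - _) = (fun w => 4 * (f w * g w))); last first.
  by apply/funext => w; ring.
by rewrite ExZ; [rewrite mulrC mulKf|exact: itgM].
Qed.

Definition nrm f := Num.sqrt (Ex P (fun w => f w ^+ 2)).

Lemma nrm_ge0 f : 0 <= nrm f. Proof. exact: sqrtr_ge0. Qed.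

Lemma nrm2 f : nrm f ^+ 2 = Ex P (fun w => f w ^+ 2).
Proof. by rewrite sqr_sqrtr// Ex_ge0// => w; exact: sqr_ge0. Qed.

Lemma cauchy_schwarz f g : L2 f -> L2 g -> `|Ex P (fun w => f w * g w)| <= nrm f * nrm g.
Proof.
move=> hf hg.
rewrite -[X in X <= _]ger0_norm// -[X in _ <= X]ger0_norm ?mulr_ge0 ?nrm_ge0//.
rewrite -ler_sqr ?nnegrE// !real_normK ?num_real// exprMn !nrm2.
set a := Ex P (fun w => f w ^+ 2); set b := Ex P (fun w => g w ^+ 2); set m := Ex _ _.
have a0 : 0 <= a by apply: Ex_ge0 => w; exact: sqr_ge0.
have b0 : 0 <= b by apply: Ex_ge0 => w; exact: sqr_ge0.
have H t : 0 <= a + 2 * (t * m) + t ^+ 2 * b.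
  have := Ex_sqrD hf (L2Z t hg).
  rewrite (_ : Ex P (fun w => f w * (t * g w)) = t * m); last first.
    by rewrite -ExZ; [congr Ex; apply/funext => w; rewrite mulrCA|exact: itgM].
  rewrite (_ : Ex P (fun w => (t * g w) ^+ 2) = t ^+ 2 * b); last first.
    by rewrite -ExZ; [congr Ex; apply/funext => w; rewrite exprMn|exact: hg.2].
  by move=> <-; apply: Ex_ge0 => w; exact: sqr_ge0.
move: b0; rewrite le_eqVlt => /orP[/eqP b0|b0].
  have [->|m0] := eqVneq m 0; first by rewrite expr0n /= -b0 mulr0.
  (* For [b = 0] the quadratic degenerates to an affine function, to which this [t] would give the
     value -1. *)
  have := H (- (a + 1) / (2 * m)).
  rewrite -b0 mulr0 addr0 (_ : 2 * _ = - (a + 1)); last by field.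
  by lra.
(* The minimiser of the quadratic. *)
have := H (- m / b).
rewrite (_ : a + _ + _ = (a * b - m ^+ 2) / b); last by field; rewrite gt_eqF.
by rewrite pmulr_lge0 ?invr_gt0// subr_ge0.
Qed.

Lemma Ex_sqr_sum_le n (f : 'I_n -> T -> R) : (forall i, L2 (f i)) ->
  Ex P (fun w => (\sum_i f i w) ^+ 2) <= (\sum_i nrm (f i)) ^+ 2.
Proof.
move=> hf.
rewrite (_ : (fun w => _) = (fun w => \sum_i \sum_j f i w * f j w)); last first.
  by apply/funext => w; rewrite expr2 big_distrl; apply: eq_bigr => i _; rewrite big_distrr.
rewrite Ex_sum; last by move=> i; apply: itg_sum => j; exact: itgM.
rewrite expr2 big_distrl; apply: ler_sum => i _; rewrite big_distrr /=.
rewrite Ex_sum; last by move=> j; exact: itgM.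
apply: ler_sum => j _; apply: le_trans (ler_norm _) _; exact: cauchy_schwarz.
Qed.

End L2.

(** * Laws and linear images of standard Gaussian vectors *)

Section Law.
Context {R : realType}.

(** The generating family of [borel_cV], named so that the Borel sets become the measurable sets of
    a [measurableType]. *)
Definition cyl n : set (set 'cV[R]_n) :=
  \bigcup_(i in [set: 'I_n]) [set (fun v : 'cV[R]_n => v i 0) @^-1` B
                             | B in [set B : set R | measurable B]].

Lemma vmeas_fun d (T : measurableType d) n (U : T -> 'cV[R]_n) :
  vmeas U -> measurable_fun setT (U : T -> g_sigma_algebraType (@cyl n)).
Proof.
move=> mU; apply: (@measurability _ _ _ (g_sigma_algebraType (@cyl n)) _ _ (@cyl n)) => //.
by move=> _ [_ [i _ [B mB <-]] <-]; exact: mU.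
Qed.

Lemma vmeas_id n : @vmeas R _ (g_sigma_algebraType (@cyl n)) n id.
Proof.
move=> k _ B mB; rewrite setTI; apply: sub_sigma_algebra.
by exists k => //; exists B.
Qed.

Lemma borel_fun_measurable n (h : 'cV[R]_n -> R) : borel_fun h <->
  measurable_fun setT (h : g_sigma_algebraType (@cyl n) -> R).
Proof.
split=> [bh _ B mB|mh B mB]; first by rewrite setTI; exact: bh.
by have := mh measurableT B mB; rewrite setTI.
Qed.

Lemma borel_comp d (T : measurableType d) n (h : 'cV[R]_n -> R) (U : T -> 'cV[R]_n) :
  borel_fun h -> vmeas U -> measurable_fun setT (fun w => h (U w)).
Proof.
move=> /borel_fun_measurable bh /vmeas_fun mU; exact: (measurableT_comp bh mU).
Qed.

Lemma borel_fun_mulmx m n (A : 'M[R]_(m, n)) (h : 'cV[R]_m -> R) :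
  borel_fun h -> borel_fun (fun u => h (A *m u)).
Proof.
by move=> bh; apply/borel_fun_measurable; apply: borel_comp => //; apply: vmeas_mulmx; exact: vmeas_id.
Qed.

Section Uniq.
Context d (T : measurableType d) (mu : {measure set T -> \bar R}) (c : R).
Context d' (T' : measurableType d') (mu' : {measure set T' -> \bar R}).
Variables (n : nat) (U : T -> 'cV[R]_n) (U' : T' -> 'cV[R]_n).
Hypotheses (hU : gstd mu c U) (hU' : gstd mu' 1 U').

Let c0 : 0 <= c.
Proof. by rewrite -lee_fin -(gstd_mass hU) measure_ge0. Qed.

Let m1 := pushm (vmeas_fun hU.1) mu.
Let m2 := mscale (NngNum c0) (pushm (vmeas_fun hU'.1) mu').

Let law_eq (E : set (g_sigma_algebraType (@cyl n))) : measurable E -> m1 E = m2 E.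
Proof.
move=> mE.
(* Boxes form a pi-system that generates the Borel sets and contains the whole space, which has
   finite mass. *)
pose G : set (set (g_sigma_algebraType (@cyl n))) :=
  [set box B | B in [set B : 'I_n -> set R | forall k, measurable (B k)]].
apply: (g_sigma_algebra_measure_unique G _ (fun=> setT)).
- by move=> _ [B mB <-]; exact: (measurable_box (@vmeas_id n) mB).
- by move=> _; exists (fun=> setT) => //; apply/seteqP; split.
- by rewrite bigcup_const//; exists 0%N.
- move=> _ _ [B mB <-] [B' mB' <-]; exists (fun k => B k `&` B' k).
    by move=> k; apply: measurableI; [exact: mB|exact: mB'].
  apply/seteqP; split => v /=.
    by move=> hv; split => k; have [] := hv k.
  by move=> [h1 h2] k; split; [exact: h1|exact: h2].
- move=> _ [B mB <-].
  have e1 : mu (U @^-1` box B) = (c%:E * mu' (U' @^-1` box B))%E.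
    by rewrite (hU.2 B mB) (hU'.2 B mB) mul1r EFinM.
  exact: e1.
- move=> _; have e1 : (mu setT < +oo)%E by rewrite (gstd_mass hU) ltry.
  exact: e1.
- have : <<s @cyl n >> E by exact: mE.
  apply: sub_sigma_algebra2 => _ [i _ [B mB <-]].
  exists (fun k => if k == i then B else setT).
    by move=> k /=; case: ifP.
  apply/seteqP; split => v /=; first by move=> hv; have := hv i; rewrite eqxx.
  by move=> hv k; case: eqP => [->|].
Qed.

Lemma gstd_law (E : set 'cV[R]_n) : borel_cV E -> mu (U @^-1` E) = (c%:E * mu' (U' @^-1` E))%E.
Proof. by move=> bE; exact: law_eq. Qed.

Lemma gstd_integral (F : 'cV[R]_n -> R) : borel_fun F -> (forall v, 0 <= F v) ->
  (\int[mu]_w (F (U w))%:E = c%:E * \int[mu']_w (F (U' w))%:E)%E.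
Proof.
move=> bF F0.
have mF : measurable_fun setT (fun v : g_sigma_algebraType (@cyl n) => (F v)%:E).
  by apply/measurable_EFinP; apply/borel_fun_measurable.
have F0' (v : g_sigma_algebraType (@cyl n)) : (0 <= (F v)%:E)%E by rewrite lee_fin.
rewrite -(ge0_integral_pushm (vmeas_fun hU.1) mu mF F0').
rewrite -(ge0_integral_pushm (vmeas_fun hU'.1) mu' mF F0').
rewrite -/m1 -[c]/((NngNum c0)%:num) -ge0_integral_mscale//.
by apply: eq_measure_integral => E mE _; exact: law_eq.
Qed.

End Uniq.

Section Lin.
Context d (T : measurableType d) (P : probability T R).
Variables (n : nat) (U : T -> 'cV[R]_n).
Hypothesis (hU : gstd P 1 U).

Lemma vmeas_row (a : 'rV[R]_n) : measurable_fun setT (fun w => (a *m U w) 0 0).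
Proof. exact: (vmeas_mulmx a hU.1). Qed.

(** A unit row vector is a coisometry with one row. *)
Lemma gstd_unit (a : 'rV[R]_n) (B : set R) : (a *m a^T) 0 0 = 1 -> measurable B ->
  P [set w | B ((a *m U w) 0 0)] = normal_prob 0 1 B.
Proof.
move=> aa mB.
have ga : good a.
  by apply: good_coisometry; apply/matrixP => i j; rewrite !ord1 aa mxE eqxx.
have [_ h] := ga _ _ _ _ _ hU.
have := h (fun=> B) (fun=> mB); rewrite mul1r big_ord1 gamE// => <-.
by congr (P _); apply/seteqP; split => w /= hw; [move=> k; rewrite ord1|exact: (hw 0)].
Qed.

Lemma mulmx_trE (a : 'rV[R]_n) : (a *m a^T) 0 0 = \sum_j a 0 j ^+ 2.
Proof. by rewrite mxE; apply: eq_bigr => j _; rewrite mxE expr2. Qed.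

Lemma mulmx_tr_ge0 (a : 'rV[R]_n) : 0 <= (a *m a^T) 0 0.
Proof. by rewrite mulmx_trE sumr_ge0// => j _; exact: sqr_ge0. Qed.

Lemma mulmx_tr_eq0 (a : 'rV[R]_n) : (a *m a^T) 0 0 = 0 -> a = 0.
Proof.
rewrite mulmx_trE => /eqP; rewrite psumr_eq0; last by move=> j _; exact: sqr_ge0.
move=> /allP h; apply/rowP => j; rewrite mxE; apply/eqP.
by have := h j (mem_index_enum _); rewrite /= sqrf_eq0.
Qed.

Lemma gstd_normalize (a : 'rV[R]_n) : a != 0 ->
  exists s : R, exists u : 'rV[R]_n, [/\ 0 < s, (u *m u^T) 0 0 = 1, a = s *: u & s ^+ 2 = (a *m a^T) 0 0].
Proof.
move=> a0; exists (Num.sqrt ((a *m a^T) 0 0)).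
have p : 0 < (a *m a^T) 0 0.
  rewrite lt_neqAle mulmx_tr_ge0 andbT eq_sym; apply: contra_neq a0.
  exact: mulmx_tr_eq0.
have s0 : 0 < Num.sqrt ((a *m a^T) 0 0) by rewrite sqrtr_gt0.
exists ((Num.sqrt ((a *m a^T) 0 0))^-1 *: a); split => //.
- have sq := sqr_sqrtr (ltW p); set r := Num.sqrt _ in s0 sq *.
  rewrite (_ : _ *m _ = (r^-1 * r^-1) *: (a *m a^T)).
    by rewrite mxE -sq; field; rewrite gt_eqF.
  by rewrite linearZ /= -scalemxAl -scalemxAr scalerA.
- by rewrite scalerA mulfV ?gt_eqF// scale1r.
- by rewrite sqr_sqrtr// ltW.
Qed.

Lemma gstd_lin_normal (a : 'rV[R]_n) : centered_normal_rv P (fun w => (a *m U w) 0 0).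
Proof.
split; first exact: vmeas_row.
have [->|/gstd_normalize[s [u [s0 uu -> _]]]] := eqVneq a 0.
  left; rewrite (_ : [set w | _] = set0) ?measure0//.
  by rewrite -subset0 => w /=; rewrite mul0mx mxE.
right; exists s; split => // B mB.
rewrite -[in RHS](gtr0_norm s0) -normal_prob_scale ?gt_eqF//.
rewrite -(gstd_unit uu); last first.
  have mm : measurable_fun setT (fun x : R => s * x) by exact: measurable_funM.
  by rewrite -[X in measurable X]setTI; exact: mm.
have E w : ((s *: u) *m U w) 0 0 = s * (u *m U w) 0 0 by rewrite -scalemxAl mxE.
by congr (P _); apply/seteqP; split => w /=; rewrite E.
Qed.

Lemma gstd_sqr_le (a : 'rV[R]_n) :
  (\int[P]_w (((a *m U w) 0 0) ^+ 2)%:E <= ((a *m a^T) 0 0)%:E)%E.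
Proof.
have [->|/gstd_normalize[s [u [s0 uu -> <-]]]] := eqVneq a 0.
  rewrite integral0_eq ?lee_fin ?mulmx_tr_ge0// => w _.
  by rewrite mul0mx mxE expr0n.
under eq_integral do rewrite -scalemxAl mxE exprMn EFinM.
rewrite ge0_integralZl//; last 3 first.
- by apply/measurable_EFinP; apply: measurable_funX; exact: vmeas_row.
- by move=> w _; rewrite lee_fin sqr_ge0.
- by rewrite lee_fin sqr_ge0.
apply: (@le_trans _ _ ((s ^+ 2)%:E * 1)%E); last by rewrite mule1.
apply: lee_wpmul2l; first by rewrite lee_fin sqr_ge0.
have mu' : measurable_fun setT (fun w => (u *m U w) 0 0 : measurableTypeR R).
  exact: vmeas_row.
apply: le_trans (@normal_prob_sqr_le1 R).
rewrite -(@ge0_integral_pushm R _ _ _ _ _ mu' P (fun x => (x ^+ 2)%:E)); last 2 first.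
- by apply/measurable_EFinP; exact: measurable_funX.
- by move=> y; rewrite lee_fin sqr_ge0.
rewrite le_eqVlt; apply/orP; left; apply/eqP.
by apply: eq_measure_integral => B mB _; rewrite pushmE; exact: gstd_unit.
Qed.

Lemma gstd_L2 (a : 'rV[R]_n) : L2 P (fun w => (a *m U w) 0 0).
Proof.
apply: L2P; first exact: vmeas_row.
by apply: le_lt_trans (gstd_sqr_le a) _; rewrite ltry.
Qed.

Lemma gstd_Ex_sqr_le (a : 'rV[R]_n) :
  Ex P (fun w => ((a *m U w) 0 0) ^+ 2) <= (a *m a^T) 0 0.
Proof. by rewrite -lee_fin -ExE; [exact: gstd_sqr_le|exact: (gstd_L2 a).2]. Qed.

End Lin.
End Law.

Definition frob {R : realType} m n (M : 'M[R]_(m, n)) : R := \sum_i \sum_j M i j ^+ 2.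

(** This is [A A^T <= I], tested on row vectors; it puts the covariance of [S A U] below
    [S S = V]. *)
Definition contraction {R : realType} m n (A : 'M[R]_(m, n)) :=
  forall v : 'rV[R]_m, (v *m A *m (v *m A)^T) 0 0 <= (v *m v^T) 0 0.

(** * The Lipschitz hypothesis on linear images of a Gaussian vector *)

Section Lip.
Context {R : realType} {dT : measure_display} {T : measurableType dT} (P : probability T R).
Variables (d N : nat) (V S : 'M[R]_d) (U : T -> 'cV[R]_N) (kappa gamma : R) (h : 'cV[R]_d -> R).
Hypotheses (hU : gstd P 1 U) (ST : S^T = S) (SS : S *m S = V).
Hypotheses (g0 : 0 < gamma) (hh : kgW_lipschitz kappa gamma V h).

Lemma mulmx_rowE n (D : 'M[R]_(n, N)) (u : 'cV[R]_N) i : (D *m u) i 0 = (row i D *m u) 0 0.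
Proof. by rewrite -row_mul [in RHS]mxE. Qed.

Lemma itgM_lin n (D : 'M[R]_(n, N)) i j :
  itg P (fun w => (D *m U w) i 0 * (D *m U w) j 0).
Proof.
under eq_fun do rewrite (mulmx_rowE _ _ i) (mulmx_rowE _ _ j).
by apply: itgM; exact: gstd_L2.
Qed.

Lemma qf_covm n (D : 'M[R]_(n, N)) (v : 'cV[R]_n) :
  qf (covm P (fun w => D *m U w)) v = Ex P (fun w => ((v^T *m D *m U w) 0 0) ^+ 2).
Proof.
have E w : (v^T *m D *m U w) 0 0 = \sum_i v i 0 * (D *m U w) i 0.
  by rewrite -mulmxA mxE; apply: eq_bigr => i _; rewrite mxE.
rewrite (_ : (fun w => _ ^+ 2) =
    (fun w => \sum_i \sum_j (v i 0 * v j 0) * ((D *m U w) i 0 * (D *m U w) j 0))); last first.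
  apply/funext => w; rewrite E expr2 big_distrl; apply: eq_bigr => i _.
  by rewrite big_distrr; apply: eq_bigr => j _; rewrite /= mulrACA.
rewrite Ex_sum; last by move=> i; apply: itg_sum => j; apply: itgZ; exact: itgM_lin.
rewrite /qf mxE; under eq_bigr do rewrite mxE big_distrl /=.
rewrite exchange_big; apply: eq_bigr => i _.
rewrite Ex_sum; last by move=> j; apply: itgZ; exact: itgM_lin.
apply: eq_bigr => j _; rewrite ExZ; last exact: itgM_lin.
by rewrite !mxE mulrAC.
Qed.

Lemma contraction_covm (A : 'M[R]_(d, N)) : contraction A ->
  loewner_le (covm P (fun w => S *m A *m U w)) V.
Proof.
move=> cA v; rewrite (_ : qf _ v = qf V v - qf (covm P (fun w => S *m A *m U w)) v); last first.
  by rewrite /qf mulmxBr mulmxBl [LHS]mxE [X in _ + X]mxE.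
rewrite qf_covm subr_ge0; apply: le_trans (gstd_Ex_sqr_le hU _) _.
rewrite mulmxA; apply: le_trans (cA (v^T *m S)) _.
by rewrite /qf trmx_mul trmxK ST mulmxA -(mulmxA _ S S) SS.
Qed.

Lemma Ex_sqnorm_le (D : 'M[R]_(d, N)) : Ex P (fun w => sqnorm (D *m U w)) <= frob D.
Proof.
rewrite /sqnorm Ex_sum; last first.
  by move=> i; under eq_fun do rewrite expr2; exact: itgM_lin.
apply: ler_sum => i _; under eq_fun do rewrite mulmx_rowE.
apply: le_trans (gstd_Ex_sqr_le hU _) _; rewrite mulmx_trE.
by apply: ler_sum => j _; rewrite mxE.
Qed.

Lemma frob_ge0 m n (M : 'M[R]_(m, n)) : 0 <= frob M.
Proof. by apply: sumr_ge0 => i _; apply: sumr_ge0 => j _; exact: sqr_ge0. Qed.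

(** Both vectors are linear images of the same [U], so the stacked pair is Gaussian, and their mean
    square distance is at most the squared Frobenius norm of the difference of the matrices. *)
Lemma gaussian_lipschitz (A B : 'M[R]_(d, N)) : contraction A -> contraction B ->
  (\int[P]_w ((h (S *m A *m U w) - h (S *m B *m U w)) ^+ 2)%:E <=
   (kappa ^+ 2 * frob (S *m A - S *m B) `^ gamma)%:E)%E.
Proof.
move=> cA cB; have [_ lip] := hh.
have G : centered_gaussian_vec P (fun w => col_mx (S *m A *m U w) (S *m B *m U w)).
  move=> u.
  rewrite (_ : (fun w => _) = (fun w => (u^T *m col_mx (S *m A) (S *m B) *m U w) 0 0)).
    exact: gstd_lin_normal.
  by apply/funext => w; rewrite -mul_col_mx mulmxA.
apply: le_trans (lip _ _ _ _ _ G (contraction_covm cA) (contraction_covm cB)) _.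
rewrite lee_fin ler_wpM2l ?sqr_ge0//.
have E : Ex P (fun w => sqnorm (S *m A *m U w - S *m B *m U w)) <= frob (S *m A - S *m B).
  under eq_fun do rewrite -mulmxBl; exact: Ex_sqnorm_le.
apply: ge0_ler_powR; [exact: ltW| |by rewrite nnegrE frob_ge0|exact: E].
by rewrite nnegrE; apply: Ex_ge0 => w; apply: sumr_ge0 => i _; exact: sqr_ge0.
Qed.

Lemma measurable_hS (A : 'M[R]_(d, N)) : measurable_fun setT (fun w => h (S *m A *m U w)).
Proof. by apply: (borel_comp hh.1); apply: vmeas_mulmx; exact: hU.1. Qed.

Lemma contraction0 m n : contraction (0 : 'M[R]_(m, n)).
Proof. by move=> v; rewrite mulmx0 mul0mx [X in X <= _]mxE mulmx_tr_ge0. Qed.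

Lemma L2_hSB (A B : 'M[R]_(d, N)) : contraction A -> contraction B ->
  L2 P (fun w => h (S *m A *m U w) - h (S *m B *m U w)).
Proof.
move=> cA cB; apply: L2P.
  by apply: measurable_funB; exact: measurable_hS.
by apply: le_lt_trans (gaussian_lipschitz cA cB) _; rewrite ltry.
Qed.

(** The hypothesis controls only differences of [h]; the comparison is with the zero matrix, for
    which the value is the constant [h 0]. *)
Lemma L2_hS (A : 'M[R]_(d, N)) : contraction A -> L2 P (fun w => h (S *m A *m U w)).
Proof.
move=> cA; have := L2D (L2_hSB cA (@contraction0 _ _)) (L2_cst P (h 0)).
by under eq_fun do rewrite mulmx0 mul0mx subrK.
Qed.

Lemma nrm_hSB_le (A B : 'M[R]_(d, N)) : contraction A -> contraction B ->
  Ex P (fun w => (h (S *m A *m U w) - h (S *m B *m U w)) ^+ 2) <=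
  kappa ^+ 2 * frob (S *m A - S *m B) `^ gamma.
Proof.
move=> cA cB; rewrite -lee_fin -ExE; last exact: (L2_hSB cA cB).2.
exact: gaussian_lipschitz.
Qed.

End Lip.

(** * The chain for a fixed sequence of indices *)

Section Matrices.
Context {R : realType} (d : nat) (S : 'M[R]_d).
Hypothesis ff : forall k, (fvec S k)^T *m fvec S k = 1%:M.

(** Applied to the input [(Z_0, g_0, ..., g_(n-1))], [Jmx] extracts [Z_0], while [erow n k] extracts
    [g_k] and is zero for [k >= n]. *)
Definition Jmx n : 'M[R]_(d, d + n) := row_mx 1%:M 0.
Definition erow n (k : nat) : 'rV[R]_(d + n) := row_mx 0 (\row_(i < n) (i == k :> nat)%:R).

Fixpoint Mm (s : nat -> 'I_d) k : 'M[R]_d :=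
  if k is k'.+1 then Pmat S (s k') *m Mm s k' else 1%:M.

(** [Bm] and [Zm] express [Y_k] and [Z_k] as linear functions of the input. The length [n] of the
    input is kept apart from the time [k], so that several times share one input vector. *)
Fixpoint Bm n (s : nat -> 'I_d) k : 'M[R]_(d, d + n) :=
  if k is k'.+1 then Pmat S (s k') *m Bm n s k' + fvec S (s k') *m erow n k' else 0.

Fixpoint Zm n (s : nat -> 'I_d) k : 'M[R]_(d, d + n) :=
  if k is k'.+1 then Pmat S (s k') *m Zm n s k' + fvec S (s k') *m erow n k' else Jmx n.

Lemma ZmE n s k : Zm n s k = Bm n s k + Mm s k *m Jmx n.
Proof.
elim: k => [|k IH] /=; first by rewrite add0r mul1mx.
by rewrite IH mulmxDr mulmxA addrAC.
Qed.

Lemma eq_seq_mx s s' n k : (forall i, (i < k)%N -> s i = s' i) ->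
  [/\ Mm s k = Mm s' k, Bm n s k = Bm n s' k & Zm n s k = Zm n s' k].
Proof.
elim: k => [//|k IH] h /=; rewrite h//.
by have [|-> -> ->] := IH => // i ik; apply: h; rewrite ltnS ltnW.
Qed.

Lemma trmx_Pmat k : (Pmat S k)^T = Pmat S k.
Proof. by rewrite /Pmat linearB /= trmx1 trmx_mul trmxK. Qed.

Lemma Pmat_fvec k : Pmat S k *m fvec S k = 0.
Proof. by rewrite /Pmat mulmxBl mul1mx -mulmxA ff mulmx1 subrr. Qed.

Lemma Pmat_idem k : Pmat S k *m Pmat S k = Pmat S k.
Proof. by rewrite {2}/Pmat mulmxBr mulmx1 mulmxA Pmat_fvec mul0mx subr0. Qed.

(** The left side is the covariance of [P_k Z + g f_k] for independent standard [Z] and [g]: one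
    step preserves the standard Gaussian law. *)
Lemma Pmat_split k : Pmat S k *m Pmat S k + fvec S k *m (fvec S k)^T = 1%:M.
Proof. by rewrite Pmat_idem /Pmat subrK. Qed.

Lemma erow_mulE n a b : (a < n)%N ->
  (erow n a *m (erow n b)^T) 0 0 = (a == b)%:R.
Proof.
move=> an; rewrite /erow tr_row_mx mul_row_col mul0mx add0r.
rewrite mxE (bigD1 (Ordinal an)) //= !mxE eqxx mul1r big1 ?addr0// => k ka.
by rewrite !mxE (_ : (k == a :> nat) = false) ?mul0r//; apply: contra_neqF ka => /eqP ka; exact: val_inj.
Qed.

Lemma erow_mul1 n a : (a < n)%N -> erow n a *m (erow n a)^T = 1%:M.
Proof.
by move=> an; apply/matrixP => i j; rewrite !ord1 erow_mulE// eqxx [RHS]mxE eqxx.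
Qed.

Lemma erow_mul0 n a b : (a < n)%N -> a != b -> erow n a *m (erow n b)^T = 0.
Proof.
by move=> an ab; apply/matrixP => i j; rewrite !ord1 erow_mulE// (negbTE ab) [RHS]mxE.
Qed.

Lemma Jmx_erow n a : Jmx n *m (erow n a)^T = 0.
Proof. by rewrite /Jmx /erow tr_row_mx mul_row_col trmx0 mulmx0 mul0mx addr0. Qed.

Lemma Jmx_tr n : Jmx n *m (Jmx n)^T = 1%:M.
Proof. by rewrite /Jmx tr_row_mx mul_row_col trmx0 trmx1 mulmx1 mulmx0 addr0. Qed.

(** Only [g_0, ..., g_(k-1)] enter [Y_k]; later noises are orthogonal to it. *)
Lemma Bm_erow n s k a : (k <= a)%N -> (k <= n)%N -> Bm n s k *m (erow n a)^T = 0.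
Proof.
elim: k => [|k IH] ka kn /=; first by rewrite mul0mx.
rewrite mulmxDl -!mulmxA (IH (ltnW ka) (ltnW kn)) mulmx0 add0r.
by rewrite (erow_mul0 kn) ?mulmx0// neq_ltn ka.
Qed.

Lemma Zm_erow n s k a : (k <= a)%N -> (k <= n)%N -> Zm n s k *m (erow n a)^T = 0.
Proof. by move=> ka kn; rewrite ZmE mulmxDl Bm_erow// add0r -mulmxA Jmx_erow mulmx0. Qed.

(** [Z_0] does not enter [Y_k], whence the independence of the two. *)
Lemma Bm_Jmx n s k : Bm n s k *m (Jmx n)^T = 0.
Proof.
elim: k => [|k IH] /=; first by rewrite mul0mx.
by rewrite mulmxDl -mulmxA IH mulmx0 add0r -mulmxA -[_ *m (Jmx n)^T]trmxK trmx_mul trmxK Jmx_erow trmx0 mulmx0.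
Qed.

Lemma coisometry_step n (Q : 'M[R]_d) (f : 'cV[R]_d) (Z : 'M[R]_(d, n)) (e : 'rV[R]_n) :
  Q^T = Q -> Q *m Q + f *m f^T = 1%:M -> Z *m Z^T = 1%:M -> Z *m e^T = 0 ->
  e *m e^T = 1%:M -> (Q *m Z + f *m e) *m (Q *m Z + f *m e)^T = 1%:M.
Proof.
move=> QT Qf ZZ Ze ee.
have eZ : e *m Z^T = 0 by rewrite -[LHS]trmxK trmx_mul trmxK Ze trmx0.
rewrite linearD /= !trmx_mul QT mulmxDl !mulmxDr.
rewrite (mulmxA _ _ Q) -(mulmxA Q Z) ZZ mulmx1.
rewrite (mulmxA _ _ f^T) -(mulmxA Q Z) Ze mulmx0 mul0mx addr0.
rewrite (mulmxA _ _ Q) -(mulmxA f e) eZ mulmx0 mul0mx add0r.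
by rewrite (mulmxA _ _ f^T) -(mulmxA f e) ee mulmx1.
Qed.

Lemma Zm_coisometry n s k : (k <= n)%N -> Zm n s k *m (Zm n s k)^T = 1%:M.
Proof.
elim: k => [|k IH] kn /=; first exact: Jmx_tr.
apply: coisometry_step; [exact: trmx_Pmat|exact: Pmat_split|exact: IH (ltnW kn)| |exact: erow_mul1].
by apply: Zm_erow; [exact: leqnn|exact: ltnW].
Qed.

(** The cross terms of [Zm Zm^T = I] vanish because [Y_k] does not involve [Z_0]. It follows that
    [Bm] is a contraction, so that [S Y_k] also meets the covariance bound. *)
Lemma Bm_Mm n s k : (k <= n)%N ->
  Bm n s k *m (Bm n s k)^T + Mm s k *m (Mm s k)^T = 1%:M.
Proof.
move=> kn; rewrite -(Zm_coisometry s kn) ZmE [in RHS]linearD /= trmx_mul mulmxDl !mulmxDr.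
rewrite [X in _ = _ + X + _]mulmxA Bm_Jmx mul0mx addr0.
have e0 : Jmx n *m (Bm n s k)^T = 0 by rewrite -[LHS]trmxK trmx_mul trmxK Bm_Jmx trmx0.
rewrite [X in _ = _ + (X + _)](_ : _ = 0) ?add0r; last by rewrite -mulmxA e0 mulmx0.
by rewrite mulmxA -(mulmxA (Mm s k) (Jmx n)) Jmx_tr mulmx1.
Qed.

(* The map sending the Gaussian input up to time [i + j] to [Z_i] and the later [g_i, ..., g_(i+j-1)]. *)
Definition Lmx (s : nat -> 'I_d) i j : 'M[R]_(d + j, d + (i + j)) :=
  col_mx (Zm (i + j) s i) (\matrix_(k < j) erow (i + j) (i + k)).

Lemma Lmx_coisometry s i j : Lmx s i j *m (Lmx s i j)^T = 1%:M.
Proof.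
rewrite /Lmx tr_col_mx mul_col_row Zm_coisometry ?leq_addr//.
have E : Zm (i + j) s i *m (\matrix_(k < j) erow (i + j) (i + k))^T = 0.
  apply/matrixP => a b; rewrite !mxE.
  have /matrixP/(_ a 0) := Zm_erow s (leq_addr b i) (leq_addr j i).
  by rewrite !mxE => H; rewrite -[RHS]H; apply: eq_bigr => k _; rewrite !mxE.
rewrite E -[X in block_mx _ _ X _]trmxK trmx_mul trmxK E trmx0 scalar_mx_block.
congr block_mx; apply/matrixP => a b; rewrite !mxE.
have ltb : (i + a < i + j)%N by rewrite ltn_add2l.
have := erow_mulE (i + b) ltb.
rewrite !mxE eqn_add2l => H; rewrite (_ : (a == b) = (a == b :> nat))// -[RHS]H.
by apply: eq_bigr => k _; rewrite !mxE.
Qed.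

Lemma erow_Lmx s i j k : (k < j)%N -> erow j k *m Lmx s i j = erow (i + j) (i + k).
Proof.
move=> kj; rewrite /Lmx /erow mul_row_col mul0mx add0r; apply/rowP => a.
rewrite mxE (bigD1 (Ordinal kj)) //= !mxE eqxx mul1r big1 ?addr0// => b bk.
by rewrite !mxE (_ : (b == k :> nat) = false) ?mul0r//; apply: contra_neqF bk => /eqP bk; exact: val_inj.
Qed.

(** The Markov property in matrix form: restarting from [Z_i] with shifted indices and noises
    continues the chain. *)
Lemma Zm_Lmx s i j k : (k <= j)%N ->
  Zm j (fun m => s (i + m)%N) k *m Lmx s i j = Zm (i + j) s (i + k).
Proof.
elim: k => [|k IH] kj.
  by rewrite addn0 /= /Jmx /Lmx mul_row_col mul1mx mul0mx addr0.
rewrite addnS /= mulmxDl -!mulmxA (IH (ltnW kj)) (erow_Lmx s i kj).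
exact: erefl.
Qed.

End Matrices.

(** * Conditioning on the indices *)

Lemma prod_EFin (R : realType) (I : Type) (s : seq I) (f : I -> R) :
  (\prod_(i <- s) (f i)%:E)%E = (\prod_(i <- s) f i)%:E.
Proof. by elim: s => [|i s IH]; rewrite ?big_nil// !big_cons IH EFinM. Qed.

Lemma integral_mrestr (R : realType) d (T : measurableType d) (mu : {measure set T -> \bar R})
    (D : set T) (mD : measurable D) (f : T -> \bar R) :
  measurable_fun setT f -> (forall x, 0 <= f x)%E ->
  (\int[mu]_x ((\1_D x)%:E * f x) = \int[mrestr mu mD]_x f x)%E.
Proof.
move=> mf f0.
have mDc : measurable (~` D) by exact: measurableC.
rewrite -[X in (_ = \int[_]_(x in X) _)%E](setUv D) ge0_integral_setU;
  [|exact: mD|exact: mDc|by rewrite setUv|by move=> x _; exact: f0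
   |by apply/disj_set2P; rewrite setICr].
rewrite [X in (_ = _ + X)%E]null_set_integral;
  [|exact: mDc|exact: measurable_funTS|by rewrite /= /mrestr setICl measure0].
rewrite adde0.
transitivity (\int[mu]_(x in D) f x)%E.
  rewrite [RHS]integral_mkcond; apply: eq_integral => x _.
  by rewrite patchE indicE; case: ifPn => _; rewrite ?mul1e ?mul0e.
by apply: eq_measure_integral => A mA AD; rewrite /= /mrestr setIidl.
Qed.

Section Cond.
Context {R : realType} {dT : measure_display} {T : measurableType dT} (P : probability T R).
Variables (d : nat) (ind : nat -> T -> 'I_d) (g : nat -> T -> R) (Z0 : T -> 'cV[R]_d).
Variable k0 : 'I_d.
Hypothesis mi : forall n (K : set 'I_d), measurable (ind n @^-1` K).
Hypothesis pi : forall n (k : 'I_d), P (ind n @^-1` [set k]) = (d%:R^-1)%:E.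
Hypothesis mg : forall n, measurable_fun setT (g n).
Hypothesis pg : forall n B, measurable B -> P (g n @^-1` B) = normal_prob 0 1 B.
Hypothesis mZ : forall k : 'I_d, measurable_fun setT (fun w => Z0 w k 0).
Hypothesis pZ : forall (k : 'I_d) B, measurable B ->
     P ((fun w => Z0 w k 0) @^-1` B) = normal_prob 0 1 B.
Hypothesis indep : mutually_independent P (indep_events ind g Z0).

Definition Uvec n (w : T) : 'cV[R]_(d + n) := col_mx (Z0 w) (\col_(k < n) g k w).

Definition Eset n (K : nat -> set 'I_d) : set T := [set w | forall k : 'I_n, K k (ind k w)].

Lemma vmeas_Uvec n : vmeas (Uvec n).
Proof.
by apply: vmeas_col_mx => // k; under eq_fun do rewrite mxE; exact: mg.
Qed.

Lemma measurable_Eset n K : measurable (Eset n K).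
Proof.
rewrite (_ : Eset n K = \bigcap_(k in [set: 'I_n]) (ind k @^-1` K k)).
  by apply: fin_bigcap_measurable => [|k _]; [exact: finite_finset|exact: mi].
by apply/seteqP; split => w /= hw k; [move=> _; exact: hw|exact: (hw k Logic.I)].
Qed.

Lemma indep_box n K (B : 'I_(d + n) -> set R) : (forall k, measurable (B k)) ->
  P (Uvec n @^-1` box B `&` Eset n K) =
  ((\prod_(k < n) fine (P (ind k @^-1` K k))) * \prod_k gam (B k))%:E.
Proof.
move=> mB.
pose F : seq (nat + (nat + 'I_d)) := map inl (index_iota 0 n) ++
  map (fun k => inr (inl k)) (index_iota 0 n) ++ map (fun k => inr (inr k)) (index_enum 'I_d).
(* The independent family is indexed by natural numbers, the box by ordinals; the default [setT] is
   never met for [k < n]. *)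
pose Bg (k : nat) := if insub k is Some i then B (rshift d (i : 'I_n)) else setT.
have Bgi (i : 'I_n) : Bg i = B (rshift d i) by rewrite /Bg valK.
have mBg k : measurable (Bg k) by rewrite /Bg; case: insub.
pose A (j : nat + (nat + 'I_d)) : set T := match j with
  | inl k => ind k @^-1` K k
  | inr (inl k) => g k @^-1` Bg k
  | inr (inr k) => (fun w => Z0 w k 0) @^-1` B (lshift n k) end.
have uF : uniq F.
  rewrite !cat_uniq !map_inj_uniq ?iota_uniq ?index_enum_uniq//=; last 3 first.
  - by move=> ? ? [].
  - by move=> ? ? [].
  - by move=> ? ? [].
  apply/and3P; split; [apply/hasPn => x|apply/hasPn => x|by rewrite ?index_enum_uniq].
    by rewrite mem_cat => /orP[] /mapP[y _ ->]; apply/mapP => -[].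
  by move=> /mapP[y _ ->]; apply/mapP => -[].
have hA j : j \in F -> indep_events ind g Z0 j (A j).
  by case: j => [k|[k|k]] _ /=; [exists (K k)|exists (Bg k)|exists (B (lshift n k))].
have := indep uF hA.
rewrite (_ : \bigcap_(j in [set` F]) A j = Uvec n @^-1` box B `&` Eset n K); last first.
  apply/seteqP; split => w /=.
    move=> hw; split => k.
      case: (split_ordP k) => i ->.
        rewrite /Uvec col_mxEu; apply: (hw (inr (inr i))) => /=.
        by rewrite !mem_cat map_f ?mem_index_enum ?orbT.
      rewrite /Uvec col_mxEd mxE -Bgi; apply: (hw (inr (inl (val i)))) => /=.
      by rewrite !mem_cat map_f ?mem_index_iota ?ltn_ord ?orbT.
    apply: (hw (inl (val k))) => /=.
    by rewrite !mem_cat map_f ?mem_index_iota ?ltn_ord.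
  move=> [hB hE] j /=; rewrite !mem_cat => /or3P[] /mapP[k kn ->] /=.
  - by move: kn; rewrite mem_index_iota => kn; exact: (hE (Ordinal kn)).
  - move: kn; rewrite mem_index_iota => kn.
    have := hB (rshift d (Ordinal kn)); rewrite /Uvec col_mxEd mxE -Bgi; exact.
  - by have := hB (lshift n k); rewrite /Uvec col_mxEu.
move=> ->.
rewrite (eq_bigr (fun j => (fine (P (A j)))%:E)); last first.
  move=> j _; rewrite fineK//; apply: fin_num_measure.
  case: j => [k|[k|k]] /=; first exact: mi.
    by rewrite -[X in measurable X]setTI; exact: mg.
  by rewrite -[X in measurable X]setTI; exact: mZ.
rewrite prod_EFin /F !big_cat !big_map /= !big_mkord; congr EFin.
congr (_ * _); rewrite big_split_ord /= mulrC; congr (_ * _).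
  by apply: eq_bigr => k _; rewrite pZ.
by apply: eq_bigr => k _; rewrite Bgi pg.
Qed.

Lemma gstd_Uvec n : gstd P 1 (Uvec n).
Proof.
split; first exact: vmeas_Uvec.
move=> B mB; rewrite mul1r.
have := @indep_box n (fun=> setT) B mB.
rewrite big1 ?mul1r; last by move=> k _; rewrite preimage_setT probability_setT.
by move=> <-; congr (P _); apply/seteqP; split => w // [].
Qed.

Definition Eseq n (s : nat -> 'I_d) := Eset n (fun k => [set s k]).

(** The indices are independent of the input, and each sequence of length [n] has probability
    [d^-n]; conditioning on one thus keeps the Gaussian law. *)
Lemma gstd_cond n s : gstd (mrestr P (measurable_Eset n (fun k => [set s k])))
  (d%:R ^- n) (Uvec n).
Proof.
split; first exact: vmeas_Uvec.
move=> B mB; rewrite /= /mrestr indep_box//; congr ((_ * _)%:E).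
under eq_bigr do rewrite pi /=.
by rewrite prodr_const card_ord exprVn.
Qed.

(* Sequences are padded with the dummy index [k0] beyond time [n]. *)
Definition ext n (s : {ffun 'I_n -> 'I_d}) (k : nat) : 'I_d :=
  if insub k is Some i then s i else k0.

Lemma ext_ord n (s : {ffun 'I_n -> 'I_d}) (i : 'I_n) : ext s i = s i.
Proof. by rewrite /ext valK. Qed.

(** The expectation over the first [n] indices. The argument takes infinite sequences, so that
    shifts can be written without casts. *)
Definition avg n (F : (nat -> 'I_d) -> R) : R :=
  d%:R ^- n * \sum_(s : {ffun 'I_n -> 'I_d}) F (ext s).

(** Such functions do not see the padding of [ext]. *)
Definition local_seq n X (F : (nat -> 'I_d) -> X) :=
  forall s s', (forall k, (k < n)%N -> s k = s' k) -> F s = F s'.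

Lemma cond_sum n (F : (nat -> 'I_d) -> 'cV[R]_(d + n) -> R) w : local_seq n F ->
  F (ind^~ w) (Uvec n w) =
  \sum_(s : {ffun 'I_n -> 'I_d}) \1_(Eseq n (ext s)) w * F (ext s) (Uvec n w).
Proof.
move=> lF; pose s0 : {ffun 'I_n -> 'I_d} := [ffun k : 'I_n => ind k w].
have Fs0 : F (ext s0) = F (ind^~ w).
  by apply: lF => k kn; have := ext_ord s0 (Ordinal kn); rewrite ffunE.
rewrite (bigD1 s0)//= big1 ?addr0; last first.
  move=> s ss0; rewrite indicE memNset ?mul0r// => hw.
  by move/eqP: ss0; apply; apply/ffunP => k; rewrite ffunE -ext_ord (hw k).
by rewrite Fs0 indicE mem_set ?mul1r// => k /=; rewrite ext_ord ffunE.
Qed.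

Section CondIntegral.
Variables (n : nat) (F : (nat -> 'I_d) -> 'cV[R]_(d + n) -> R).
Hypotheses (bF : forall s, borel_fun (F s)) (lF : local_seq n F).

Lemma cond_measurable : measurable_fun setT (fun w => F (ind^~ w) (Uvec n w)).
Proof.
under eq_fun do rewrite (cond_sum _ lF).
apply: measurable_sum => s; apply: measurable_funM.
  by apply: measurable_indic; exact: measurable_Eset.
by apply: borel_comp => //; exact: vmeas_Uvec.
Qed.

Lemma cond_integral : (forall s v, 0 <= F s v) ->
  (\int[P]_w (F (ind^~ w) (Uvec n w))%:E =
   \sum_(s : {ffun 'I_n -> 'I_d}) (d%:R ^- n)%:E * \int[P]_w (F (ext s) (Uvec n w))%:E)%E.
Proof.
move=> F0.
have mFs s : measurable_fun setT (fun w => F s (Uvec n w)).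
  by apply: borel_comp => //; exact: vmeas_Uvec.
under eq_integral do rewrite (cond_sum _ lF) -sumEFin.
rewrite ge0_integral_sum//; last 2 first.
- move=> s; apply/measurable_EFinP; apply: measurable_funM => //.
  by apply: measurable_indic; exact: measurable_Eset.
- by move=> s w _; rewrite lee_fin mulr_ge0.
apply: eq_bigr => s _; under eq_integral do rewrite EFinM.
rewrite (integral_mrestr _ (measurable_Eset n (fun k => [set ext s k]))); last 2 first.
- exact/measurable_EFinP.
- by move=> w; rewrite lee_fin.
exact: (gstd_integral (gstd_cond n (ext s)) (gstd_Uvec n)).
Qed.

End CondIntegral.

Section CondL2.
Variables (n : nat) (F : (nat -> 'I_d) -> 'cV[R]_(d + n) -> R).
Hypotheses (bF : forall s, borel_fun (F s)) (lF : local_seq n F).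
Hypothesis L2F : forall s, L2 P (fun w => F s (Uvec n w)).

(** Integrability of the mixture comes from here: its second moment is a finite average of finite
    ones. *)
Lemma cond_L2 : L2 P (fun w => F (ind^~ w) (Uvec n w)) /\
  Ex P (fun w => F (ind^~ w) (Uvec n w) ^+ 2) =
  avg n (fun s => Ex P (fun w => F s (Uvec n w) ^+ 2)).
Proof.
pose F2 s v := F s v ^+ 2.
have bF2 s : borel_fun (F2 s).
  by apply/borel_fun_measurable; apply: measurable_funX; apply/borel_fun_measurable.
have lF2 : local_seq n F2 by move=> s s' ss; rewrite /F2 (lF ss).
have I : (\int[P]_w (F2 (ind^~ w) (Uvec n w))%:E =
    (avg n (fun s => Ex P (fun w => F s (Uvec n w) ^+ 2)))%:E)%E.
  rewrite (cond_integral bF2 lF2); last by move=> s v; exact: sqr_ge0.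
  rewrite /avg big_distrr /= -sumEFin; apply: eq_bigr => s _.
  by rewrite EFinM -ExE//; exact: (L2F (ext s)).2.
split; first by apply: L2P; [exact: cond_measurable|rewrite I ltry].
by rewrite /Ex I.
Qed.

End CondL2.

Lemma avgB n F G : avg n (fun s => F s - G s) = avg n F - avg n G.
Proof. by rewrite /avg -mulrBr -sumrB. Qed.

Lemma avgZ n a F : avg n (fun s => a * F s) = a * avg n F.
Proof. by rewrite /avg -big_distrr /= mulrCA. Qed.

Lemma avgD n F G : avg n (fun s => F s + G s) = avg n F + avg n G.
Proof. by rewrite /avg -mulrDr -big_split. Qed.

Lemma ler_avg n F G : (forall s, F s <= G s) -> avg n F <= avg n G.
Proof.
by move=> FG; rewrite /avg ler_wpM2l ?invr_ge0 ?exprn_ge0//; apply: ler_sum => s _.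
Qed.

Lemma dR_neq0 : (d%:R : R) != 0.
Proof. by rewrite pnatr_eq0 -lt0n; apply: leq_ltn_trans (ltn_ord k0). Qed.

Lemma avg_cst n a : avg n (fun=> a) = a.
Proof.
rewrite /avg sumr_const card_ffun !card_ord -[a *+ _]mulr_natl natrX mulrA mulVf ?mul1r//.
by rewrite expf_neq0// dR_neq0.
Qed.

Definition scons (k : 'I_d) (s : nat -> 'I_d) (m : nat) := if m is m'.+1 then s m' else k.

(** The first index is split off rather than the last: the shift drops the oldest indices, and in
    [Mm] the oldest projection acts first on the vector. *)
Lemma avgS n F : avg n.+1 F = d%:R^-1 * \sum_k avg n (fun s => F (scons k s)).
Proof.
rewrite /avg -big_distrr /= mulrA -invfM -exprS; congr (_ * _).
pose f (p : 'I_d * {ffun 'I_n -> 'I_d}) : {ffun 'I_n.+1 -> 'I_d} :=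
  [ffun i => oapp p.2 p.1 (unlift ord0 i)].
pose f' (s : {ffun 'I_n.+1 -> 'I_d}) : 'I_d * {ffun 'I_n -> 'I_d} :=
  (s ord0, [ffun i => s (lift ord0 i)]).
rewrite (reindex f) /=; last first.
  exists f' => [[k s] _|s _]; rewrite /f /f'.
    by congr (_, _); [rewrite ffunE unlift_none|apply/ffunP => i; rewrite !ffunE liftK].
  apply/ffunP => i; rewrite ffunE /=; case: unliftP => [j ->|->] //=.
  by rewrite ffunE.
rewrite pair_big /=; apply: eq_bigr => -[k s] _ /=; congr (F _).
apply/funext => -[|m] /=.
  by rewrite (ext_ord (f (k, s)) ord0) ffunE unlift_none.
have [mn|mn] := ltnP m n.
  rewrite (ext_ord (f (k, s)) (lift ord0 (Ordinal mn))) ffunE liftK /=.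
  by rewrite (ext_ord s (Ordinal mn)).
(* Past the end, both sequences are padded with [k0]. *)
by rewrite /ext !insubF// ltnNge ?ltnS mn.
Qed.

Lemma avg_shift i j F : avg (i + j) (fun s => F (fun m => s (i + m)%N)) = avg j F.
Proof.
elim: i => [//|i IH]; rewrite addSn avgS.
rewrite (eq_bigr (fun=> avg j F)); last by move=> k _; rewrite -IH.
by rewrite sumr_const card_ord -[avg j F *+ d]mulr_natl mulrA mulVf ?mul1r// dR_neq0.
Qed.

Lemma cond_ExM n (F G : (nat -> 'I_d) -> 'cV[R]_(d + n) -> R) :
  (forall s, borel_fun (F s)) -> local_seq n F -> (forall s, L2 P (fun w => F s (Uvec n w))) ->
  (forall s, borel_fun (G s)) -> local_seq n G -> (forall s, L2 P (fun w => G s (Uvec n w))) ->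
  Ex P (fun w => F (ind^~ w) (Uvec n w) * G (ind^~ w) (Uvec n w)) =
  avg n (fun s => Ex P (fun w => F s (Uvec n w) * G s (Uvec n w))).
Proof.
move=> bF lF hF bG lG hG.
have [LF _] := cond_L2 bF lF hF; have [LG _] := cond_L2 bG lG hG.
rewrite (Ex_polar LF LG).
pose D s v := F s v + G s v; pose B s v := F s v - G s v.
have bD s : borel_fun (D s).
  by apply/borel_fun_measurable; apply: measurable_funD; apply/borel_fun_measurable.
have bB s : borel_fun (B s).
  by apply/borel_fun_measurable; apply: measurable_funB; apply/borel_fun_measurable.
have lD : local_seq n D by move=> s s' ss; rewrite /D (lF _ _ ss) (lG _ _ ss).
have lB : local_seq n B by move=> s s' ss; rewrite /B (lF _ _ ss) (lG _ _ ss).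
have [_ ->] := cond_L2 bD lD (fun s => L2D (hF s) (hG s)).
have [_ ->] := cond_L2 bB lB (fun s => L2B (hF s) (hG s)).
rewrite -avgB mulrC -avgZ; congr avg; apply/funext => s.
by rewrite (Ex_polar (hF s) (hG s)) mulrC.
Qed.

End Cond.

(** * Contraction in mean *)

Section Decay.
Context {R : realType} (d : nat) (V S : 'M[R]_d) (k0 : 'I_d).
Hypotheses (Vpd : pd V) (V1 : forall k : 'I_d, V k k = 1) (ST : S^T = S) (SS : S *m S = V).

Lemma S_symE a b : S a b = S b a.
Proof. by rewrite -{1}ST mxE. Qed.

Lemma fvec_unit k : (fvec S k)^T *m fvec S k = 1%:M.
Proof.
apply/matrixP => i j; rewrite !ord1 [RHS]mxE eqxx -(V1 k) -SS !mxE.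
by apply: eq_bigr => l _; rewrite !mxE (S_symE l k).
Qed.

Lemma sqnormE n (x : 'cV[R]_n) : (x^T *m x) 0 0 = sqnorm x.
Proof. by rewrite mxE; apply: eq_bigr => i _; rewrite mxE expr2. Qed.

Lemma sqnorm_ge0 n (x : 'cV[R]_n) : 0 <= sqnorm x.
Proof. by apply: sumr_ge0 => i _; exact: sqr_ge0. Qed.

(** Lagrange's identity: the gap is half the sum of the squared minors [a i * b j - a j * b i]. *)
Lemma cauchy_schwarz_sum n (a b : 'I_n -> R) :
  (\sum_i a i * b i) ^+ 2 <= (\sum_i a i ^+ 2) * (\sum_i b i ^+ 2).
Proof.
rewrite -subr_ge0.
have : 0 <= \sum_i \sum_j (a i * b j - a j * b i) ^+ 2.
  by apply: sumr_ge0 => i _; apply: sumr_ge0 => j _; exact: sqr_ge0.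
have -> : \sum_i \sum_j (a i * b j - a j * b i) ^+ 2 =
  2 * ((\sum_i a i ^+ 2) * (\sum_i b i ^+ 2) - (\sum_i a i * b i) ^+ 2).
  have E1 : \sum_i \sum_j a i ^+ 2 * b j ^+ 2 = (\sum_i a i ^+ 2) * (\sum_i b i ^+ 2).
    by rewrite big_distrl; apply: eq_bigr => i _; rewrite big_distrr.
  have E2 : \sum_i \sum_j a j ^+ 2 * b i ^+ 2 = (\sum_i a i ^+ 2) * (\sum_i b i ^+ 2).
    by rewrite exchange_big E1.
  have E3 : \sum_i \sum_j (a i * b i) * (a j * b j) = (\sum_i a i * b i) ^+ 2.
    by rewrite expr2 big_distrl; apply: eq_bigr => i _; rewrite big_distrr.
  rewrite -E3 mulrBr mulr_natl mulr2n -{1}E1 -E2 big_distrr -big_split -sumrB /=.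
  apply: eq_bigr => i _; rewrite big_distrr -big_split -sumrB /=.
  by apply: eq_bigr => j _; ring.
by rewrite pmulr_rge0.
Qed.

Lemma sqnorm_mulmx_le m n (A : 'M[R]_(m, n)) (x : 'cV[R]_n) :
  sqnorm (A *m x) <= frob A * sqnorm x.
Proof.
rewrite /sqnorm /frob big_distrl; apply: ler_sum => i _; rewrite mxE.
exact: cauchy_schwarz_sum.
Qed.

Lemma frob_cols m n (A : 'M[R]_(m, n)) : frob A = \sum_j sqnorm (col j A).
Proof.
rewrite /frob exchange_big; apply: eq_bigr => j _; apply: eq_bigr => i _.
by rewrite mxE.
Qed.

(** A left kernel vector of [S] would be isotropic for [V = S S], against definiteness. *)
Lemma S_unit : S \in unitmx.
Proof.
rewrite unitmxE unitfE; apply/negP => /det0P[v v0 vS].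
have [_ /(_ v^T)] := Vpd.
rewrite -[v^T == 0]trmx_eq0 trmxK => /(_ v0).
by rewrite /qf trmxK -SS mulmxA vS !mul0mx mxE ltxx.
Qed.

(* The summand 2 only ensures [1 / 2 <= rate]. *)
Definition coerc : R := frob (invmx S) + 2.

Lemma coerc_gt0 : 0 < coerc.
Proof. by rewrite /coerc ltr_wpDl ?frob_ge0. Qed.

(** Since [|S x|^2 = x^T V x], the inverse of [coerc] serves as a lower bound [lambda] for [V]. *)
Lemma sqnorm_coercive (x : 'cV[R]_d) : sqnorm x <= coerc * sqnorm (S *m x).
Proof.
have e : x = invmx S *m (S *m x) by rewrite mulKmx// S_unit.
rewrite {1}e; apply: le_trans (sqnorm_mulmx_le _ _) _.
by rewrite ler_wpM2r ?sqnorm_ge0// /coerc lerDl.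
Qed.

Definition rate : R := 1 - (d%:R * coerc)^-1.

Let d1 : 1 <= d%:R :> R.
Proof. by rewrite ler1n; apply: leq_ltn_trans (ltn_ord k0). Qed.

Lemma dc_ge2 : 2 <= d%:R * coerc.
Proof.
have c2 : 2 <= coerc by rewrite /coerc lerDr frob_ge0.
by apply: (le_trans c2); rewrite ler_peMl// ltW// coerc_gt0.
Qed.

Lemma rate_gt0 : 0 < rate.
Proof.
rewrite subr_gt0 invf_lt1; first by apply: lt_le_trans dc_ge2; rewrite ltr1n.
by apply: lt_le_trans dc_ge2.
Qed.

Lemma rate_lt1 : rate < 1.
Proof.
rewrite /rate ltrBlDr ltrDl invr_gt0; by apply: lt_le_trans dc_ge2.
Qed.

(** Pythagoras: [P_k] removes the component along the unit vector [f_k], which is [(S x)_k] as [f_k]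
    is a column of the symmetric [S]. *)
Lemma sqnorm_Pmat k (x : 'cV[R]_d) :
  sqnorm (Pmat S k *m x) = sqnorm x - ((S *m x) k 0) ^+ 2.
Proof.
have fx : (fvec S k)^T *m x = ((S *m x) k 0)%:M.
  apply/matrixP => i j; rewrite !ord1 [RHS]mxE mulr1n !mxE; apply: eq_bigr => l _.
  by rewrite !mxE (S_symE l k).
have Px : Pmat S k *m x = x - ((S *m x) k 0) *: fvec S k.
  by rewrite /Pmat mulmxBl mul1mx -mulmxA fx mul_mx_scalar.
have PP : (Pmat S k *m x)^T *m (Pmat S k *m x) = x^T *m (Pmat S k *m x).
  by rewrite trmx_mul trmx_Pmat -mulmxA (mulmxA (Pmat S k)) (Pmat_idem fvec_unit).
rewrite -!sqnormE PP Px mulmxBr [LHS]mxE; congr (_ + _).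
rewrite -scalemxAr -[x^T *m fvec S k]trmxK trmx_mul trmxK fx tr_scalar_mx.
by rewrite !mxE mulr1n expr2.
Qed.

(** Over all [k], the removed squares [(S x)_k^2] add up to [|S x|^2], which coercivity bounds from
    below. *)
Lemma avg_Pmat (x : 'cV[R]_d) :
  d%:R^-1 * \sum_k sqnorm (Pmat S k *m x) <= rate * sqnorm x.
Proof.
under eq_bigr do rewrite sqnorm_Pmat.
rewrite sumrB sumr_const card_ord -[sqnorm x *+ d]mulr_natl mulrBr mulKf ?(dR_neq0 k0)//.
rewrite -/(sqnorm (S *m x)) /rate mulrBl mul1r lerD2l lerN2 invfM -mulrA.
rewrite ler_wpM2l ?invr_ge0//.
by rewrite ler_pdivrMl ?coerc_gt0// sqnorm_coercive.
Qed.

Lemma Mm_scons k s n : Mm S (scons k s) n.+1 = Mm S s n *m Pmat S k.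
Proof.
elim: n => [|n IH]; first by rewrite /= mul1mx mulmx1.
by rewrite [LHS]/= [Mm S s n.+1]/= -mulmxA -IH.
Qed.

Lemma avg_sqnorm_Mm n (x : 'cV[R]_d) :
  avg k0 n (fun s => sqnorm (Mm S s n *m x)) <= rate ^+ n * sqnorm x.
Proof.
elim: n x => [|n IH] x.
  by under [X in avg _ _ X]eq_fun do rewrite /= mul1mx; rewrite avg_cst expr0 mul1r.
rewrite avgS; apply: (@le_trans _ _ (d%:R^-1 * \sum_k (rate ^+ n * sqnorm (Pmat S k *m x)))).
  rewrite ler_wpM2l ?invr_ge0//; apply: ler_sum => k _.
  by under [X in avg _ _ X]eq_fun do rewrite Mm_scons -mulmxA; exact: IH.
rewrite -big_distrr /= mulrCA exprSr -mulrA ler_wpM2l ?exprn_ge0 ?(ltW rate_gt0)//.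
exact: avg_Pmat.
Qed.

(** The difference [Zm - Bm] is [Mm Jmx], whose nonzero columns are the images under [Mm] of the [d]
    basis vectors; each contributes at most [rate^n] in mean. *)
Lemma avg_frob n :
  avg k0 n (fun s => frob (S *m Zm S n s n - S *m Bm S n s n)) <=
  frob S * d%:R * rate ^+ n.
Proof.
have E s : frob (S *m Zm S n s n - S *m Bm S n s n) <= frob S * \sum_j sqnorm (Mm S s n *m (delta_mx j 0 : 'cV_d)).
  rewrite ZmE -mulmxBr addrAC subrr add0r /Jmx.
  rewrite mul_mx_row mulmx1 mulmx0 mul_mx_row mulmx0 frob_cols big_split_ord /=.
  rewrite [X in _ + X]big1 ?addr0; last first.
    move=> j _; rewrite colKr col0 /sqnorm big1// => i _; by rewrite mxE expr0n.
  rewrite big_distrr; apply: ler_sum => j _; rewrite colKl colE -mulmxA.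
  exact: sqnorm_mulmx_le.
apply: le_trans (ler_avg _ _ E) _.
rewrite avgZ -mulrA ler_wpM2l ?frob_ge0//.
have -> : avg k0 n (fun s => \sum_j sqnorm (Mm S s n *m (delta_mx j 0 : 'cV_d))) =
  \sum_j avg k0 n (fun s => sqnorm (Mm S s n *m (delta_mx j 0 : 'cV_d))).
  by rewrite /avg exchange_big big_distrr.
have -> : d%:R * rate ^+ n = \sum_(j < d) rate ^+ n :> R.
  by rewrite sumr_const card_ord mulr_natl.
apply: ler_sum => j _; apply: le_trans (avg_sqnorm_Mm _ _) _.
rewrite (_ : sqnorm _ = 1) ?mulr1//.
rewrite /sqnorm (bigD1 j)//= mxE !eqxx expr1n big1 ?addr0// => i ij.
by rewrite mxE (negbTE ij) expr0n.
Qed.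

End Decay.

(** * Mean square of a sum with summable covariances *)

Section Asymptotics.
Context {R : realType} {d : measure_display} {T : measurableType d} (P : probability T R).
Variables (H K : nat -> T -> R) (C q C' : R) (cov : nat -> R).
Hypotheses (LH : forall j, L2 P (H j)) (LK : forall j, L2 P (K j)).
Hypotheses (C0 : 0 <= C) (q0 : 0 <= q) (q1 : q < 1).
Hypothesis near : forall j, nrm P (fun w => K j w - H j w) <= C * q ^+ j.
Hypothesis statio : forall i j, Ex P (fun w => H i w * H (i + j)%N w) = cov j.
Hypothesis decay : forall j, `|cov j.+1| <= C' * q ^+ j.

Lemma cvg_series_cov : cvgn (series (fun j => cov j.+1)).
Proof.
apply: normed_cvg; apply: (@series_le_cvg _ _ (geometric C' q)).
- by move=> n; exact: normr_ge0.
- by move=> n; rewrite /geometric /=; apply: le_trans (decay n); exact: normr_ge0.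
- by move=> n; exact: decay.
- by apply: is_cvg_geometric_series; rewrite ger0_norm.
Qed.

Let u n := Ex P (fun w => (\sum_(i < n) H i w) ^+ 2).

Let LsumH n : L2 P (fun w => \sum_(i < n) H i w).
Proof. exact: L2_sum. Qed.

(** The increments of [u] are partial sums converging to the announced limit, so [u n / n] is a
    Cesaro mean of them. *)
Let u_step n : u n.+1 = u n + (cov 0 + 2 * series (fun j => cov j.+1) n).
Proof.
rewrite /u; under eq_fun do rewrite big_ord_recr /=.
rewrite (Ex_sqrD (LsumH n) (LH n)) -addrA; congr (_ + _); rewrite addrC; congr (_ + 2 * _).
  by rewrite -(statio n 0) addn0; congr Ex; apply/funext => w; rewrite expr2.
rewrite /series /= big_mkord.
rewrite (_ : (fun w => _) = (fun w => \sum_(i < n) H i w * H n w)); last first.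
  by apply/funext => w; rewrite big_distrl.
rewrite Ex_sum; last by move=> i; exact: itgM.
(* The pair [(i, n)] has lag [n - i]; reversing the sum orders it by lag, from 1 to [n]. *)
rewrite (reindex_inj rev_ord_inj) /=; apply: eq_bigr => i _.
rewrite -(statio (n - i.+1) i.+1) subnK//.
Qed.

Let cvg_u : (fun n => n.+1%:R^-1 * u n.+1) @ \oo -->
  cov 0 + 2 * limn (series (fun j => cov j.+1)).
Proof.
pose a n := cov 0 + 2 * series (fun j => cov j.+1) n.
have ca : a @ \oo --> cov 0 + 2 * limn (series (fun j => cov j.+1)).
  apply: cvgD; first exact: cvg_cst.
  by apply: cvgM; [exact: cvg_cst|exact: cvg_series_cov].
have us n : series a n = u n.
  elim: n => [|n IH]; last by rewrite /series /= big_nat_recr //= u_step -IH.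
  rewrite /series /= big_nil /u; under eq_fun do rewrite big_ord0 expr0n /=.
  by rewrite Ex_cst.
have := cesaro ca; rewrite /arithmetic_mean /=.
by under eq_fun do rewrite us.
Qed.

Let b n := Ex P (fun w => (\sum_(i < n) (K i w - H i w)) ^+ 2).
(** The sum of the geometric bounds on the norms of [K i - H i]. *)
Let D := C / (1 - q).

Let b_le n : b n <= D ^+ 2.
Proof.
apply: le_trans (Ex_sqr_sum_le _) _; first by move=> i; exact: L2B.
have s0 : 0 <= \sum_(i < n) nrm P (fun w => K i w - H i w).
  by apply: sumr_ge0 => i _; exact: nrm_ge0.
rewrite ler_sqr ?nnegrE//; last by rewrite divr_ge0// subr_ge0 ltW.
apply: (@le_trans _ _ (\sum_(i < n) C * q ^+ i)); first by apply: ler_sum => i _; exact: near.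
rewrite -big_distrr /= /D ler_wpM2l// -[X in _ <= X]mul1r ler_pdivlMr ?subr_gt0//.
rewrite mulrC -[1 - q]opprB mulNr -subrX1 opprB gerBl exprn_ge0//.
Qed.

Let b_ge0 n : 0 <= b n.
Proof. by apply: Ex_ge0 => w; exact: sqr_ge0. Qed.

Let Dn n := D ^+ 2 * n.+1%:R^-1.

Let cvgD0 : Dn @ \oo --> 0.
Proof.
rewrite -(mulr0 (D ^+ 2)); apply: cvgM; first exact: cvg_cst.
exact: cvg_harmonic.
Qed.

Let bn_le n : n.+1%:R^-1 * b n.+1 <= Dn n.
Proof. by rewrite mulrC /Dn ler_wpM2r ?invr_ge0. Qed.

Let cvg_b : (fun n => n.+1%:R^-1 * b n.+1) @ \oo --> 0.
Proof.
apply: (squeeze_cvgr (f := fun=> 0) (h := Dn)); last 2 first.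
- exact: cvg_cst.
- exact: cvgD0.
by near=> n; rewrite bn_le andbT mulr_ge0 ?invr_ge0.
Unshelve. all: by end_near. Qed.

Let x n := Ex P (fun w => (\sum_(i < n) H i w) * (\sum_(i < n) (K i w - H i w))).

(** By Cauchy-Schwarz [|x n| / n] is at most the product of the roots of [u n / n], which converges,
    and of [b n / n], which tends to 0. *)
Let cvg_x : (fun n => n.+1%:R^-1 * x n.+1) @ \oo --> 0.
Proof.
apply/norm_cvg0P.
pose y n := Num.sqrt (n.+1%:R^-1 * u n.+1) * Num.sqrt (Dn n).
apply: (squeeze_cvgr (f := fun=> 0) (h := y)); last 2 first.
- exact: cvg_cst.
- rewrite -(mulr0 (Num.sqrt (cov 0 + 2 * limn (series (fun j => cov j.+1))))).
  apply: cvgM.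
    by apply: (cvg_comp _ _ cvg_u); exact: sqrt_continuous.
  rewrite -[0 in X in _ --> X]sqrtr0.
  by apply: (cvg_comp _ _ cvgD0); exact: sqrt_continuous.
near=> n; rewrite normr_ge0 /=.
have n0 : 0 <= n.+1%:R^-1 :> R by rewrite invr_ge0.
have u0 : 0 <= u n.+1 by apply: Ex_ge0 => w; exact: sqr_ge0.
rewrite normrM ger0_norm//.
have := cauchy_schwarz (LsumH n.+1) (L2_sum (index_enum 'I_n.+1) (fun i => L2B (LK i) (LH i))).
rewrite -/(x n.+1) /nrm -/(u n.+1) -/(b n.+1) => h.
apply: (@le_trans _ _ (Num.sqrt (n.+1%:R^-1 * u n.+1) * Num.sqrt (n.+1%:R^-1 * b n.+1))).
  rewrite !sqrtrM// mulrACA -expr2 sqr_sqrtr// ler_wpM2l//.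
by rewrite ler_wpM2l ?sqrtr_ge0// ler_wsqrtr.
Unshelve. all: by end_near. Qed.

Lemma cvg_mean_square :
  (fun n : nat => n%:R * Ex P (fun w => ((\sum_(j < n) K j w) / n%:R) ^+ 2)) @ \oo -->
  cov 0 + 2 * limn (series (fun j => cov j.+1)).
Proof.
(* From here on the denominator [n.+1] is nonzero. *)
rewrite -cvg_shiftS /=.
rewrite (_ : (fun n => _) = (fun n => n.+1%:R^-1 * u n.+1 +
   (2 * (n.+1%:R^-1 * x n.+1) + n.+1%:R^-1 * b n.+1))).
  have -> : cov 0 + 2 * limn (series (fun j => cov j.+1)) =
      cov 0 + 2 * limn (series (fun j => cov j.+1)) + (2 * 0 + 0) :> R.
    by rewrite mulr0 !addr0.
  apply: cvgD; first exact: cvg_u.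
  apply: cvgD; last exact: cvg_b.
  by apply: cvgM; [exact: cvg_cst|exact: cvg_x].
apply/funext => n.
have LB : L2 P (fun w => \sum_(i < n.+1) (K i w - H i w)) by apply: L2_sum => i; exact: L2B.
have -> : Ex P (fun w => ((\sum_(j < n.+1) K j w) / n.+1%:R) ^+ 2) =
  n.+1%:R ^- 2 * Ex P (fun w => (\sum_(i < n.+1) H i w + \sum_(i < n.+1) (K i w - H i w)) ^+ 2).
  rewrite -ExZ; last exact: (L2D (LsumH n.+1) LB).2.
  congr Ex; apply/funext => w; rewrite -big_split /=.
  have -> : \sum_(i < n.+1) (H i w + (K i w - H i w)) = \sum_(i < n.+1) K i w.
    by apply: eq_bigr => i _; rewrite addrC subrK.
  by rewrite exprMn mulrC exprVn.
rewrite (Ex_sqrD (LsumH n.+1) LB) -/(u n.+1) -/(b n.+1) -/(x n.+1) expr2 invfM !mulrA mulfV ?mul1r//; ring.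
Qed.

End Asymptotics.

(** * Independence *)

Section Indep.
Context {R : realType} {d : measure_display} {T : measurableType d} (P : probability T R).

Lemma Ex_indep (X Y : T -> R) : L2 P X -> L2 P Y ->
  (forall B C : set R, measurable B -> measurable C ->
    P (X @^-1` B `&` Y @^-1` C) = (P (X @^-1` B) * P (Y @^-1` C))%E) ->
  Ex P (fun w => X w * Y w) = Ex P X * Ex P Y.
Proof.
move=> LX LY ind.
have mX : measurable_fun setT (X : T -> measurableTypeR R) by exact: LX.1.
have mY : measurable_fun setT (Y : T -> measurableTypeR R) by exact: LY.1.
pose X' : {mfun T >-> measurableTypeR R} := HB.pack X (isMeasurableFun.Build _ _ _ _ _ mX).
pose Y' : {mfun T >-> measurableTypeR R} := HB.pack Y (isMeasurableFun.Build _ _ _ _ _ mY).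
pose p w : measurableTypeR R * measurableTypeR R := (X w, Y w).
have mp : measurable_fun setT p by apply/measurable_fun_pairP; split.
pose m1 := distribution P X'; pose m2 := distribution P Y'.
pose f (z : measurableTypeR R * measurableTypeR R) : \bar R := (z.1 * z.2)%:E.
have mf : measurable_fun setT f by apply/measurable_EFinP; apply: measurable_funM.
have law E : measurable E -> (m1 \x m2)%E E = pushm mp P E.
  by apply: product_measure_unique => // B C mB mC; rewrite pushmE; exact: ind.
have iXY : P.-integrable (p @^-1` setT) (f \o p) by exact: (itgM LX LY).
have ip : (pushm mp P).-integrable setT f by exact: (integrable_pushforward mp mf iXY measurableT).
have i12 : (m1 \x m2)%E.-integrable setT f.
  apply/integrableP; split => //; have /integrableP[_] := ip.
  by rewrite (eq_measure_integral (m1 \x m2)%E)// => A mA _; exact/esym/law.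
have mid : measurable_fun setT (fun x : measurableTypeR R => x%:E : \bar R).
  exact/measurable_EFinP.
have jX : P.-integrable (X @^-1` setT) ((fun x : measurableTypeR R => x%:E) \o X).
  exact: (L2_itg LX).
have jY : P.-integrable (Y @^-1` setT) ((fun x : measurableTypeR R => x%:E) \o Y).
  exact: (L2_itg LY).
have eX : (\int[m1]_x x%:E)%E = (Ex P X)%:E.
  rewrite -ExE; last exact: L2_itg.
  exact: (integral_pushforward mX mid jX measurableT).
have eY : (\int[m2]_x x%:E)%E = (Ex P Y)%:E.
  rewrite -ExE; last exact: L2_itg.
  exact: (integral_pushforward mY mid jY measurableT).
have iX : m1.-integrable setT (fun x : measurableTypeR R => x%:E).
  exact: (integrable_pushforward mX mid jX measurableT).
have iY : m2.-integrable setT (fun x : measurableTypeR R => x%:E).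
  exact: (integrable_pushforward mY mid jY measurableT).
apply: EFin_inj; rewrite -ExE; last exact: itgM.
transitivity (\int[m1 \x m2]_z f z)%E.
  rewrite (eq_measure_integral (pushm mp P)); last by move=> A mA _; exact: law.
  by rewrite (integral_pushforward mp mf iXY measurableT).
rewrite -integral12_prod_meas1// /fubini_F /f /=.
under eq_integral do (under eq_integral do rewrite EFinM; rewrite integralZl// eY).
by rewrite integralZr// eX -EFinM.
Qed.

Lemma gstd_indep m n (U : T -> 'cV[R]_(m + n)) (f : 'cV[R]_m -> R) (g : 'cV[R]_n -> R) :
  gstd P 1 U -> borel_fun f -> borel_fun g ->
  L2 P (fun w => f (usubmx (U w))) -> L2 P (fun w => g (dsubmx (U w))) ->
  Ex P (fun w => f (usubmx (U w)) * g (dsubmx (U w))) =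
  Ex P (fun w => f (usubmx (U w))) * Ex P (fun w => g (dsubmx (U w))).
Proof.
move=> hU bf bg Lf Lg; apply: Ex_indep => // B C mB mC.
have hu := gstd_usub hU; have hd := gstd_dsub hU.
set X := fun w => f (usubmx (U w)).
have mXB : measurable (X @^-1` B) by rewrite -[X in measurable X]setTI; exact: Lf.1.
have fin : P (X @^-1` B) = (fine (P (X @^-1` B)))%:E.
  by rewrite fineK// fin_num_measure.
(* Uniqueness of laws is used twice: here for a box on the lower block and the event [B] on the
   upper one, then below to pass from boxes to an arbitrary Borel event on the lower block. *)
have hr : gstd (mrestr P mXB) (fine (P (X @^-1` B))) (fun w => dsubmx (U w)).
  split; first exact: hd.1.
  move=> B2 mB2.
  have := gstd_law (gstd_restr_u (measurable_box hd.1 mB2) mB2 hU) hu (bf B mB).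
  rewrite /= /mrestr mul1r => E.
  rewrite setIC; etransitivity; first exact: E.
  rewrite [RHS]EFinM -fin muleC; exact: erefl.
have := gstd_law hr hd (bg C mC).
by rewrite /= /mrestr setIC => ->; rewrite -fin.
Qed.

Lemma gstd_L2_eq n (U U' : T -> 'cV[R]_n) (f : 'cV[R]_n -> R) :
  gstd P 1 U -> gstd P 1 U' -> borel_fun f -> L2 P (fun w => f (U w)) ->
  L2 P (fun w => f (U' w)) /\ Ex P (fun w => f (U w) ^+ 2) = Ex P (fun w => f (U' w) ^+ 2).
Proof.
move=> hU hU' bf Lf.
have bf2 : borel_fun (fun v => f v ^+ 2).
  by apply/borel_fun_measurable; apply: measurable_funX; apply/borel_fun_measurable.
have E := gstd_integral hU hU' bf2 (fun v => sqr_ge0 _); rewrite mul1e in E.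
split; last by rewrite /Ex E.
apply: L2P; first exact: (borel_comp bf hU'.1).
by rewrite -E ExE ?ltry//; exact: Lf.2.
Qed.

Lemma gstd_ExM_eq n (U U' : T -> 'cV[R]_n) (f g : 'cV[R]_n -> R) :
  gstd P 1 U -> gstd P 1 U' -> borel_fun f -> borel_fun g ->
  L2 P (fun w => f (U w)) -> L2 P (fun w => g (U w)) ->
  Ex P (fun w => f (U w) * g (U w)) = Ex P (fun w => f (U' w) * g (U' w)).
Proof.
move=> hU hU' bf bg Lf Lg.
have [Lf' _] := gstd_L2_eq hU hU' bf Lf; have [Lg' _] := gstd_L2_eq hU hU' bg Lg.
have bD : borel_fun (fun v => f v + g v).
  by apply/borel_fun_measurable; apply: measurable_funD; apply/borel_fun_measurable.
have bB : borel_fun (fun v => f v - g v).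
  by apply/borel_fun_measurable; apply: measurable_funB; apply/borel_fun_measurable.
rewrite (Ex_polar Lf Lg) (Ex_polar Lf' Lg').
rewrite (gstd_L2_eq hU hU' bD (L2D Lf Lg)).2.
by rewrite (gstd_L2_eq hU hU' bB (L2B Lf Lg)).2.
Qed.

End Indep.

(** * The theorem *)

Section Processes.
Context {R : realType} {d : nat} {dT : measure_display} {T : measurableType dT}.
Variables (V S : 'M[R]_d) (ind : nat -> T -> 'I_d) (g : nat -> T -> R) (Z0 : T -> 'cV[R]_d).
Hypotheses (ST : S^T = S) (SS : S *m S = V).

Lemma erow_Uvec N j w : (j < N)%N -> erow d N j *m Uvec g Z0 N w = (g j w)%:M.
Proof.
move=> jN; rewrite /erow /Uvec mul_row_col mul0mx add0r; apply/matrixP => a b.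
rewrite !ord1 !mxE mulr1n (bigD1 (Ordinal jN))//= !mxE eqxx mul1r big1 ?addr0// => i ij.
by rewrite !mxE (_ : (i == j :> nat) = false) ?mul0r//; apply: contra_neqF ij => /eqP ij; exact: val_inj.
Qed.

Lemma Yproc_mx N j w : (j <= N)%N ->
  Yproc S ind g j w = Bm S N (ind^~ w) j *m Uvec g Z0 N w.
Proof.
elim: j => [|j IH] jN /=; first by rewrite mul0mx.
rewrite (IH (ltnW jN)) mulmxDl -!mulmxA (erow_Uvec w jN) mul_mx_scalar.
exact: erefl.
Qed.

Lemma Mproc_mx j w : Mproc S ind j w = Mm S (ind^~ w) j.
Proof. by elim: j => [//|j IH] /=; rewrite IH. Qed.

Lemma Zproc_mx N j w : (j <= N)%N ->
  Zproc S ind g Z0 j w = Zm S N (ind^~ w) j *m Uvec g Z0 N w.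
Proof.
move=> jN; rewrite /Zproc (Yproc_mx _ jN) Mproc_mx ZmE mulmxDl -mulmxA; congr (_ + _ *m _).
by rewrite /Jmx /Uvec mul_row_col mul1mx mul0mx addr0.
Qed.

(** The two recursions match because [V e_k = S f_k] and [e_k^T S y = f_k^T y]. *)
Lemma Xproc_Yproc j w : Xproc V ind g j w = S *m Yproc S ind g j w.
Proof.
elim: j => [|j IH] /=; first by rewrite mulmx0.
set k := ind j w; set y := Yproc S ind g j w; rewrite IH -/y.
have fy : (fvec S k)^T *m y = ((S *m y) k 0)%:M.
  apply/matrixP => a b; rewrite !ord1 [RHS]mxE mulr1n !mxE; apply: eq_bigr => l _.
  by rewrite !mxE -{1}ST mxE.
have VS : col k V = S *m fvec S k by rewrite -SS /fvec !colE mulmxA.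
rewrite /Pmat mulmxBl mul1mx -(mulmxA (fvec S k)) fy mul_mx_scalar.
by rewrite VS mulmxDr mulmxBr -!scalemxAr scalerBl addrAC addrA.
Qed.

End Processes.

(* Averaged over [t] with mean at most a multiple of [l], this stands in for Jensen's inequality. *)
Lemma powR_le_affine (R : realType) (t l y : R) : 0 <= t -> 0 < l -> 0 < y <= 1 ->
  t `^ y <= l `^ y * (1 + t / l).
Proof.
move=> t0 l0 /andP[y0 y1].
have tl : 0 <= t / l by rewrite divr_ge0// ltW.
have -> : t `^ y = l `^ y * (t / l) `^ y.
  by rewrite -powRM// ?(ltW l0)// mulrC divfK// gt_eqF.
rewrite ler_wpM2l ?powR_ge0//.
have [h|h] := leP (t / l) 1.
  apply: (@le_trans _ _ 1); last by rewrite lerDl.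
  have e1 : 1 `^ y = 1 :> R by rewrite powR1.
  by rewrite -[X in _ <= X]e1; apply: ge0_ler_powR; rewrite ?nnegrE//; exact: ltW.
apply: (@le_trans _ _ (t / l)); last by rewrite lerDr.
by rewrite -[X in _ <= X]powRr1//; apply: ler_powR => //; exact: ltW.
Qed.

(** * Stationarity, decay of the covariances and conclusion *)

Section Main.
Context {R : realType} {d : nat} {dT : measure_display} {T : measurableType dT}.
Variables (V S : 'M[R]_d) (P : probability T R).
Variables (ind : nat -> T -> 'I_d) (g : nat -> T -> R) (Z0 : T -> 'cV[R]_d).
Variables (kappa gamma : R) (h : 'cV[R]_d -> R) (k0 : 'I_d).
Hypothesis Vpd : pd V.
Hypothesis V1 : forall k : 'I_d, V k k = 1.
Hypothesis ST : S^T = S.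
Hypothesis SS : S *m S = V.
Hypothesis mi : forall n (K : set 'I_d), measurable (ind n @^-1` K).
Hypothesis pi : forall n (k : 'I_d), P (ind n @^-1` [set k]) = (d%:R^-1)%:E.
Hypothesis mg : forall n, measurable_fun setT (g n).
Hypothesis pg : forall n B, measurable B -> P (g n @^-1` B) = normal_prob 0 1 B.
Hypothesis mZ : forall k : 'I_d, measurable_fun setT (fun w => Z0 w k 0).
Hypothesis pZ : forall (k : 'I_d) B, measurable B ->
     P ((fun w => Z0 w k 0) @^-1` B) = normal_prob 0 1 B.
Hypothesis indep : mutually_independent P (indep_events ind g Z0).
Hypothesis gamma01 : 0 < gamma <= 1.
Hypothesis lip : kgW_lipschitz kappa gamma V h.

Let m := Ex P (fun w => h (S *m Z0 w)).
Let H j w := h (S *m Zproc S ind g Z0 j w) - m.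
Let K j w := h (Xproc V ind g j w) - m.
Let U n := Uvec g Z0 n.
Let hU n : gstd P 1 (U n) := gstd_Uvec mi mg pg mZ pZ indep n.
Let ff := fvec_unit V1 ST SS.
Let gamma0 : 0 < gamma. Proof. by case/andP: gamma01. Qed.

Let FZ n j (s : nat -> 'I_d) (u : 'cV[R]_(d + n)) := h (S *m Zm S n s j *m u) - m.
Let FB n j (s : nat -> 'I_d) (u : 'cV[R]_(d + n)) := h (S *m Bm S n s j *m u) - m.

Let HE n j w : (j <= n)%N -> H j w = FZ j (ind^~ w) (U n w).
Proof. by move=> jn; rewrite /H /FZ (Zproc_mx _ _ _ _ _ jn) mulmxA. Qed.

Let KE n j w : (j <= n)%N -> K j w = FB j (ind^~ w) (U n w).
Proof.
by move=> jn; rewrite /K /FB (Xproc_Yproc _ _ ST SS) (Yproc_mx _ _ _ Z0 _ jn) mulmxA.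
Qed.

Let borel_h n (A : 'M[R]_(d, n)) : borel_fun (fun u => h (A *m u) - m).
Proof.
apply/borel_fun_measurable; apply: measurable_funB => //.
by apply/borel_fun_measurable; apply: borel_fun_mulmx; exact: lip.1.
Qed.

Let bFZ n j s : borel_fun (@FZ n j s). Proof. exact: borel_h. Qed.
Let bFB n j s : borel_fun (@FB n j s). Proof. exact: borel_h. Qed.

Let lFZ n j : (j <= n)%N -> local_seq n (@FZ n j).
Proof.
move=> jn s s' ss; rewrite /FZ.
by have [|_ _ ->] := @eq_seq_mx _ _ S s s' n j; first by move=> i ij; apply: ss; exact: leq_trans jn.
Qed.

Let lFB n j : (j <= n)%N -> local_seq n (@FB n j).
Proof.
move=> jn s s' ss; rewrite /FB.
by have [|_ -> _] := @eq_seq_mx _ _ S s s' n j; first by move=> i ij; apply: ss; exact: leq_trans jn.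
Qed.

Let cZ n j s : (j <= n)%N -> contraction (Zm S n s j).
Proof.
move=> jn v; rewrite trmx_mul mulmxA -(mulmxA v) (Zm_coisometry ff s jn) mulmx1//.
Qed.

Let cB n j s : (j <= n)%N -> contraction (Bm S n s j).
Proof.
move=> jn v.
have := Bm_Mm ff s jn => /(congr1 (fun M => (v *m M *m v^T) 0 0)).
rewrite mulmx1 mulmxDr mulmxDl [X in X = _]mxE => <-.
rewrite trmx_mul !mulmxA lerDl -(mulmxA (v *m _)) -trmx_mul.
exact: mulmx_tr_ge0.
Qed.

Let L2FZ n j s : (j <= n)%N -> L2 P (fun w => FZ j s (U n w)).
Proof. by move=> jn; apply: L2B; [exact: (L2_hS (hU n) ST SS gamma0 lip (cZ s jn))|exact: L2_cst]. Qed.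

Let L2FB n j s : (j <= n)%N -> L2 P (fun w => FB j s (U n w)).
Proof. by move=> jn; apply: L2B; [exact: (L2_hS (hU n) ST SS gamma0 lip (cB s jn))|exact: L2_cst]. Qed.

Let LH j : L2 P (H j).
Proof.
have [L _] := cond_L2 k0 mi pi mg pg mZ pZ indep (bFZ j) (lFZ (leqnn j)) (fun s => L2FZ s (leqnn j)).
by rewrite (_ : H j = (fun w => FZ j (ind^~ w) (U j w)))//; apply/funext => w; exact: HE.
Qed.

Let LK j : L2 P (K j).
Proof.
have [L _] := cond_L2 k0 mi pi mg pg mZ pZ indep (bFB j) (lFB (leqnn j)) (fun s => L2FB s (leqnn j)).
by rewrite (_ : K j = (fun w => FB j (ind^~ w) (U j w)))//; apply/funext => w; exact: KE.
Qed.

Let ExH0 : Ex P (H 0) = 0.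
Proof.
have E w : h (S *m Z0 w) = H 0 w + m by rewrite /H /Zproc /= add0r mul1mx subrK.
have := erefl m; rewrite {1}/m; under eq_fun do rewrite E.
rewrite ExD; [|exact: L2_itg|exact: itg_cst].
by rewrite Ex_cst => /eqP; rewrite -subr_eq0 addrK => /eqP.
Qed.

Let rho := rate S.
Let rho0 : 0 < rho. Proof. exact: (rate_gt0 S k0). Qed.
Let rho1 : rho < 1. Proof. exact: (rate_lt1 S k0). Qed.
Let C2 := kappa ^+ 2 * (1 + frob S * d%:R).
Let C2_ge0 : 0 <= C2.
Proof. by rewrite mulr_ge0 ?sqr_ge0// addr_ge0// mulr_ge0// frob_ge0. Qed.
Let q2 := rho `^ gamma.
Let q2_gt0 : 0 < q2. Proof. exact: powR_gt0. Qed.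
Let q2_lt1 : q2 < 1.
Proof.
by rewrite /q2 /powR gt_eqF// expR_lt1 pmulr_rlt0// ln_lt0// rho0.
Qed.

Let diff_le j : Ex P (fun w => (K j w - H j w) ^+ 2) <= C2 * q2 ^+ j.
Proof.
pose F s u := FB j s u - @FZ j j s u.
have bF s : borel_fun (F s).
  by apply/borel_fun_measurable; apply: measurable_funB; apply/borel_fun_measurable.
have lF : local_seq j F.
  by move=> s s' ss; rewrite /F (lFB (leqnn j) ss) (lFZ (leqnn j) ss).
have [_] := cond_L2 k0 mi pi mg pg mZ pZ indep bF lF
  (fun s => L2B (L2FB s (leqnn j)) (L2FZ s (leqnn j))).
rewrite (_ : (fun w => (K j w - H j w) ^+ 2) = (fun w => F (ind^~ w) (U j w) ^+ 2)); last first.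
  by apply/funext => w; rewrite /F -HE// -KE.
(* The mean Frobenius distance is at most [frob S * d * l]; the affine majorant at scale [l]
   therefore averages to [l^gamma = q2^j] times [1 + frob S * d], the factor in [C2]. *)
move=> ->; pose l := rho ^+ j.
have l0 : 0 < l by rewrite exprn_gt0.
have lg : l `^ gamma = q2 ^+ j.
  suff E i : (rho ^+ i) `^ gamma = q2 ^+ i by exact: E.
  rewrite /q2; elim: i => [|i IH]; first by rewrite !expr0 powR1.
  by rewrite !exprS powRM ?exprn_ge0 ?(ltW rho0)// IH.
have st s : Ex P (fun w => F s (U j w) ^+ 2) <=
    kappa ^+ 2 * q2 ^+ j + kappa ^+ 2 * q2 ^+ j / l * frob (S *m Zm S j s j - S *m Bm S j s j).
  have := nrm_hSB_le (hU j) ST SS gamma0 lip (cZ s (leqnn j)) (cB s (leqnn j)).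
  rewrite (_ : (fun w => _ ^+ 2) = (fun w => F s (U j w) ^+ 2)); last first.
    by apply/funext => w; rewrite /F /FB /FZ; ring.
  move=> /le_trans; apply.
  have := powR_le_affine (frob_ge0 (S *m Zm S j s j - S *m Bm S j s j)) l0 gamma01.
  rewrite lg => /(ler_wpM2l (sqr_ge0 kappa)) /le_trans; apply.
  by rewrite le_eqVlt; apply/orP; left; apply/eqP; field; rewrite gt_eqF.
apply: le_trans (ler_avg k0 j st) _; rewrite avgD avg_cst avgZ.
have := avg_frob k0 Vpd V1 ST SS j; rewrite -/rho -/l => af.
have c0 : 0 <= kappa ^+ 2 * q2 ^+ j / l.
  apply: divr_ge0; last exact: ltW.
  by apply: mulr_ge0; [exact: sqr_ge0|rewrite exprn_ge0// ltW].
apply: (@le_trans _ _ (kappa ^+ 2 * q2 ^+ j + kappa ^+ 2 * q2 ^+ j / l * (frob S * d%:R * l))).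
  by rewrite lerD2l ler_wpM2l.
by rewrite le_eqVlt; apply/orP; left; apply/eqP; rewrite /C2; field; rewrite gt_eqF.
Qed.

Let C := Num.sqrt C2.
(** Square roots pass from mean squares to [L^2] norms. *)
Let q := Num.sqrt q2.
Let q_ge0 : 0 <= q. Proof. exact: sqrtr_ge0. Qed.
Let q_lt1 : q < 1.
Proof. by rewrite -[X in _ < X]sqrtr1 ltr_sqrt. Qed.

Let near j : nrm P (fun w => K j w - H j w) <= C * q ^+ j.
Proof.
rewrite /nrm; apply: (@le_trans _ _ (Num.sqrt (C2 * q2 ^+ j))).
  by rewrite ler_wsqrtr// diff_le.
rewrite sqrtrM// (_ : Num.sqrt (q2 ^+ j) = q ^+ j)//.
rewrite -{1}(sqr_sqrtr (ltW q2_gt0)) exprAC sqrtr_sqr ger0_norm//.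
Qed.

Let cov j := Ex P (fun w => H 0 w * H j w).

Let statio i j : Ex P (fun w => H i w * H (i + j)%N w) = cov j.
Proof.
pose G s := Ex P (fun w => @FZ j 0 s (U j w) * @FZ j j s (U j w)).
transitivity (avg k0 j G); last first.
  rewrite /cov (_ : (fun w => _ * _) =
    (fun w => @FZ j 0 (ind^~ w) (U j w) * @FZ j j (ind^~ w) (U j w))); last first.
    by apply/funext => w; rewrite -!HE.
  by rewrite (cond_ExM k0 mi pi mg pg mZ pZ indep (bFZ 0) (lFZ (leq0n j))
    (fun s => L2FZ s (leq0n j)) (bFZ j) (lFZ (leqnn j)) (fun s => L2FZ s (leqnn j))).
have ij := leq_addr j i.
rewrite (_ : (fun w => _ * _) = (fun w => @FZ (i + j) i (ind^~ w) (U (i + j) w) *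
    @FZ (i + j) (i + j) (ind^~ w) (U (i + j) w))); last first.
  by apply/funext => w; rewrite -!HE.
rewrite (cond_ExM k0 mi pi mg pg mZ pZ indep (bFZ i) (lFZ ij)
  (fun s => L2FZ s ij) (bFZ (i + j)) (lFZ (leqnn (i + j))) (fun s => L2FZ s (leqnn (i + j)))).
(* Averaging over [i + j] indices a quantity that sees only the last [j] of them equals averaging
   over [j]; it remains to compare for one frozen sequence, where [Lmx] preserves the Gaussian
   law. *)
rewrite -(avg_shift k0 i j G); congr avg; apply/funext => s; rewrite /G.
set s' := fun k => s (i + k)%N.
have gW : gstd P 1 (fun w => Lmx S s i j *m U (i + j) w).
  by apply: (good_coisometry (Lmx_coisometry ff s i j)); exact: hU.
have e1 w : @FZ (i + j) i s (U (i + j) w) = @FZ j 0 s' (Lmx S s i j *m U (i + j) w).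
  have := Zm_Lmx S s i (leq0n j); rewrite addn0 /FZ => <-.
  by rewrite !mulmxA.
have e2 w : @FZ (i + j) (i + j) s (U (i + j) w) = @FZ j j s' (Lmx S s i j *m U (i + j) w).
  have := Zm_Lmx S s i (leqnn j); rewrite /FZ => <-.
  by rewrite !mulmxA.
rewrite (_ : (fun w => _ * _) = (fun w => @FZ j 0 s' (Lmx S s i j *m U (i + j) w) *
   @FZ j j s' (Lmx S s i j *m U (i + j) w))); last first.
  by apply/funext => w; rewrite e1 e2.
symmetry; exact: (gstd_ExM_eq (hU j) gW (@bFZ j 0 s') (@bFZ j j s')
  (L2FZ s' (leq0n j)) (L2FZ s' (leqnn j))).
Qed.

(** For frozen indices [H 0] depends on the [Z_0] block of the input and [K j] on the block of the
    [g_k]; the two are independent and [H 0] is centered. *)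
Let ExH0K j : Ex P (fun w => H 0 w * K j w) = 0.
Proof.
rewrite (_ : (fun w => _ * _) =
    (fun w => @FZ j 0 (ind^~ w) (U j w) * @FB j j (ind^~ w) (U j w))); last first.
  by apply/funext => w; rewrite -HE// -KE.
rewrite (cond_ExM k0 mi pi mg pg mZ pZ indep (bFZ 0) (lFZ (leq0n j))
    (fun s => L2FZ s (leq0n j)) (bFB j) (lFB (leqnn j)) (fun s => L2FB s (leqnn j))).
rewrite -(avg_cst k0 j 0); congr avg; apply/funext => s.
pose f (z : 'cV[R]_d) := h (S *m z) - m.
pose B' := rsubmx (Bm S j s j).
pose f' (y : 'cV[R]_j) := h (S *m B' *m y) - m.
have BE : Bm S j s j = row_mx 0 B'.
  rewrite -[LHS]hsubmxK; congr row_mx.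
  have := Bm_Jmx S j s j; rewrite -[X in X *m _]hsubmxK /Jmx tr_row_mx mul_row_col.
  by rewrite trmx0 trmx1 mulmx0 addr0 mulmx1.
have eZ w : @FZ j 0 s (U j w) = f (usubmx (U j w)).
  rewrite /FZ /f /= /Jmx -[X in _ *m X]vsubmxK -mulmxA mul_row_col.
  by rewrite mul1mx mul0mx addr0 ?col_mxKu.
have eB w : @FB j j s (U j w) = f' (dsubmx (U j w)).
  rewrite /FB /f' BE -[X in _ *m X]vsubmxK -mulmxA mul_row_col.
  by rewrite mul0mx add0r mulmxA ?col_mxKd.
have Lf := L2FZ s (leq0n j); have Lf' := L2FB s (leqnn j).
rewrite (funext eZ) in Lf; rewrite (funext eB) in Lf'.
rewrite (_ : (fun w => _ * _) = (fun w => f (usubmx (U j w)) * f' (dsubmx (U j w)))); last first.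
  by apply/funext => w; rewrite eZ eB.
rewrite (gstd_indep (hU j) (borel_h _) (borel_h _) Lf Lf').
rewrite (_ : (fun w => f _) = H 0) ?ExH0 ?mul0r//.
by apply/funext => w; rewrite -eZ (HE w (leq0n j)).
Qed.

Let decay j : `|cov j.+1| <= nrm P (H 0) * C * q ^+ j.
Proof.
have LD := L2B (LK j.+1) (LH j.+1).
have -> : cov j.+1 = - Ex P (fun w => H 0 w * (K j.+1 w - H j.+1 w)).
  rewrite (_ : (fun w => _ * _) = (fun w => H 0 w * K j.+1 w - H 0 w * H j.+1 w)); last first.
    by apply/funext => w; rewrite mulrBr.
  by rewrite ExB ?ExH0K ?sub0r ?opprK//; exact: itgM.
rewrite normrN -mulrA; apply: le_trans (cauchy_schwarz (LH 0) LD) _.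
rewrite ler_wpM2l ?nrm_ge0//; apply: le_trans (near _) _.
(* The estimate at time [j.+1] carries one more factor [q <= 1], which is dropped. *)
by rewrite ler_wpM2l ?sqrtr_ge0// exprS ler_piMl ?exprn_ge0// ltW.
Qed.

(** As [H 0] has mean zero, subtracting [m] from the second factor leaves the covariance unchanged,
    whatever the mean of that factor. *)
Lemma covh_cov j : Ex P (fun w => h (S *m Z0 w) * h (S *m Zproc S ind g Z0 j w))
                - m * Ex P (fun w => h (S *m Zproc S ind g Z0 j w)) = cov j.
Proof.
have E0 w : h (S *m Z0 w) = H 0 w + m by rewrite /H /Zproc /= add0r mul1mx subrK.
have Ej w : h (S *m Zproc S ind g Z0 j w) = H j w + m by rewrite /H subrK.
have iH := itgM (LH 0) (LH j).
under eq_fun do rewrite E0 Ej.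
under [X in _ - _ * Ex _ X]eq_fun do rewrite Ej.
rewrite (_ : (fun w => _ * _) = (fun w => (H 0 w * H j w + m * H 0 w) + m * (H j w + m))); last first.
  by apply/funext => w; ring.
have i0 := L2_itg (LH 0).
have ij : itg P (fun w => H j w + m) by apply: itgD; [exact: L2_itg|exact: itg_cst].
rewrite (ExD (itgD iH (itgZ m i0)) (itgZ m ij)) (ExD iH (itgZ m i0)).
by rewrite (ExZ m i0) (ExZ m ij) ExH0 mulr0 addr0 addrK.
Qed.

Lemma varh_cov : Ex P (fun w => (h (S *m Z0 w) - m) ^+ 2) = cov 0.
Proof.
congr Ex; apply/funext => w; rewrite expr2.
by rewrite /H /Zproc /= add0r mul1mx.
Qed.

Lemma main_asymptotics :
  cvgn (series (fun j => cov j.+1)) /\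
  (fun n : nat => n%:R *
     Ex P (fun w => ((\sum_(j < n) h (Xproc V ind g j w)) / n%:R - m) ^+ 2))
    @ \oo --> cov 0 + 2 * limn (series (fun j => cov j.+1)).
Proof.
split; first exact: (cvg_series_cov q_ge0 q_lt1 decay).
rewrite (_ : (fun n : nat => _) =
  (fun n : nat => n%:R * Ex P (fun w => ((\sum_(j < n) K j w) / n%:R) ^+ 2))).
  exact: (cvg_mean_square LH LK (sqrtr_ge0 _) q_ge0 q_lt1 near statio decay).
(* At [n = 0] the integrands may differ, the empty average being 0 rather than [m], but the factor
   [n] cancels both. *)
apply/funext => -[|n]; first by rewrite !mul0r.
congr (_ * Ex _ _); apply/funext => w; congr (_ ^+ 2).
rewrite /K sumrB sumr_const card_ord -[m *+ _]mulr_natr mulrBl mulfK//.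
Qed.

End Main.

Theorem theorem5p1 (R : realType) (d : nat) (V S : 'M[R]_d)
  (dT : measure_display) (T : measurableType dT) (P : probability T R)
  (ind : nat -> T -> 'I_d) (g : nat -> T -> R) (Z0 : T -> 'cV[R]_d)
  (kappa gamma : R) (h : 'cV[R]_d -> R) :
  (0 < d)%N ->
  (* V : symmetric, positive definite, unit diagonal *)
  pd V -> (forall k : 'I_d, V k k = 1) ->
  (* S = sqrt V : the symmetric positive semi-definite square root of V *)
  psd S -> S *m S = V ->
  (* i_n i.i.d. uniform on {1..d} *)
  (forall n (K : set 'I_d), measurable (ind n @^-1` K)) ->
  (forall n (k : 'I_d), P (ind n @^-1` [set k]) = (d%:R^-1)%:E) ->
  (* g_n i.i.d. standard Gaussian *)
  (forall n, measurable_fun setT (g n)) ->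
  (forall n B, measurable B -> P (g n @^-1` B) = normal_prob 0 1 B) ->
  (* Z_0 has i.i.d. standard Gaussian coordinates *)
  (forall k : 'I_d, measurable_fun setT (fun w => Z0 w k 0)) ->
  (forall (k : 'I_d) B, measurable B ->
     P ((fun w => Z0 w k 0) @^-1` B) = normal_prob 0 1 B) ->
  (* (i_n), (g_n), and the coordinates of Z_0 are all mutually independent *)
  mutually_independent P (indep_events ind g Z0) ->
  (* h is (kappa, gamma, V)-Lipschitz *)
  0 < kappa -> 0 < gamma <= 1 -> kgW_lipschitz kappa gamma V h ->
  let m := Ex P (fun w => h (S *m Z0 w)) in
  let varh := Ex P (fun w => (h (S *m Z0 w) - m) ^+ 2) in
  let covh j := Ex P (fun w => h (S *m Z0 w) * h (S *m Zproc S ind g Z0 j w))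
                - m * Ex P (fun w => h (S *m Zproc S ind g Z0 j w)) in
  cvgn (series (fun j => covh j.+1)) /\
  (fun n : nat => n%:R *
     Ex P (fun w => ((\sum_(j < n) h (Xproc V ind g j w)) / n%:R - m) ^+ 2))
    @ \oo --> varh + 2 * limn (series (fun j => covh j.+1)).
Proof.
move=> d0 Vpd V1 [ST _] SS mi pi mg pg mZ pZ indep _ gam01 lip m varh covh.
pose k0 := Ordinal d0.
have E j : covh j = Ex P (fun w => (h (S *m Zproc S ind g Z0 0 w) - m) * (h (S *m Zproc S ind g Z0 j w) - m)).
  exact: (covh_cov k0 V1 ST SS mi pi mg pg mZ pZ indep gam01 lip j).
rewrite (_ : (fun j => covh j.+1) = (fun j => Ex P (fun w => (h (S *m Zproc S ind g Z0 0 w) - m) *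
   (h (S *m Zproc S ind g Z0 j.+1 w) - m)))); last by apply/funext => j; exact: E.
rewrite (_ : varh = Ex P (fun w => (h (S *m Zproc S ind g Z0 0 w) - m) *
   (h (S *m Zproc S ind g Z0 0 w) - m))); last exact: varh_cov.
exact: (main_asymptotics k0 Vpd V1 ST SS mi pi mg pg mZ pZ indep gam01 lip).
Qed.
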